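(* Let $X_1,\dots,X_n$ be independent random variables, each with a probability density function $f_i\colon[-1,1]\to[0,\phi]$. Let $m\in[n]$, let $A\in\{-1,0,1\}^{m\times n}$ be a matrix of full rank, let $k\in[m-1]$ be an integer, let $(Y_1,\dots,Y_{m-k},Z_1,\dots,Z_k)^{\mathsf T}=A\cdot(X_1,\dots,X_n)^{\mathsf T}$, and let $C$ be a function mapping each tuple $(y_1,\dots,y_{m-k})\in\mathbb{R}^{m-k}$ to a hypercube $C(y_1,\dots,y_{m-k})\subseteq\mathbb{R}^k$ with side length $\varepsilon$. Then \[ \Pr\big[(Z_1,\dots,Z_k)\in C(Y_1,\dots,Y_{m-k})\big]\le(2n)^{n-k}\cdot\phi^n\cdot\varepsilon^k. \] If all densities $f_i$ are quasiconcave, then even \[ \Pr\big[(Z_1,\dots,Z_k)\in C(Y_1,\dots,Y_{m-k})\big]\le 2^k\cdot n^{n-k}\cdot\phi^k\cdot\varepsilon^k. \]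
   Context: $[n]=\{1,\dots,n\}$. A density $f\colon[-1,1]\to[0,\phi]$ is quasiconcave if there is $x_0\in[-1,1]$ such that $f$ is non-decreasing on $[-1,x_0]$ and non-increasing on $[x_0,1]$. A hypercube with side length $\varepsilon$ in $\mathbb{R}^k$ is a product of $k$ intervals of length $\varepsilon$.
   Formalization: The function C is additionally assumed to be Borel measurable, in the sense that the set of all (y,z) with z in C(y) is a Borel set; for arbitrary C the probability may be undefined or, even when defined, the bound may fail. *)

(* Defs.v *)
From HB Require Import structures.
From mathcomp Require Import all_boot all_order all_algebra.
From mathcomp Require Import all_classical all_reals all_analysis.

Set Implicit Arguments.
Unset Strict Implicit.
Unset Printing Implicit Defensive.

Import Order.TTheory GRing.Theory Num.Theory.
Import numFieldNormedType.Exports.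

Local Open Scope classical_set_scope.
Local Open Scope ring_scope.

Definition independent_RVs (d : measure_display) (T : measurableType d)
    (R : realType) (P : probability T R) (n : nat)
    (X : 'I_n -> {RV P >-> R}) : Prop :=
  forall (J : {set 'I_n}) (B : 'I_n -> set R),
    (forall i, i \in J -> measurable (B i)) ->
    P (\bigcap_(i in [set i | i \in J]) (X i @^-1` B i))
      = (\prod_(i in J) P (X i @^-1` B i))%E.

(* A density [-1, 1] -> [0, phi] is represented by a function on R whose values
   outside [-1, 1] are irrelevant. That it integrates to 1 follows from taking
   B = setT. *)
Definition has_density (d : measure_display) (T : measurableType d)
    (R : realType) (P : probability T R) (X : {RV P >-> R})
    (phi : R) (f : R -> R) : Prop :=
  [/\ measurable_fun (`[-1, 1]%classic : set R) f,
      (forall x, x \in `[-1, 1] -> 0 <= f x <= phi) &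
      (forall B : set R, measurable B ->
         P (X @^-1` B)
           = (\int[lebesgue_measure]_(x in B `&` `[(-1)%R, 1%R])
                (f x)%:E)%E)].

Definition quasiconcave (R : realType) (f : R -> R) : Prop :=
  exists x0 : R,
    [/\ x0 \in `[-1, 1],
        {in `[-1, x0] &, {homo f : x y / x <= y}} &
        {in `[x0, 1] &, {homo f : x y /~ x <= y}}].

(* The intervals may be open, closed or half-open, independently of each
   other; the Boolean flags say which endpoints are included. *)
Definition hypercube (R : realType) (k : nat) (eps : R)
    (H : set (k.-tuple R)) : Prop :=
  exists (a : 'I_k -> R) (bl br : 'I_k -> bool),
    H = [set z | forall j : 'I_k,
           tnth z j \in Interval (BSide (bl j) (a j))
                                 (BSide (br j) (a j + eps))].

Definition first_coords (R : realType) (m k : nat) (v : 'cV[R]_m) :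
    (m - k).-tuple R :=
  [tuple v (widen_ord (leq_subr k m) j) 0 | j < m - k].

Definition last_coords (R : realType) (m k : nat) (km : (k <= m)%N)
    (v : 'cV[R]_m) : k.-tuple R :=
  [tuple v (cast_ord (subnK km) (rshift (m - k) j)) 0 | j < k].

Definition linear_image (d : measure_display) (T : measurableType d)
    (R : realType) (P : probability T R) (m n : nat) (A : 'M[R]_(m, n))
    (X : 'I_n -> {RV P >-> R}) (w : T) : 'cV[R]_m :=
  A *m \col_i X i w.

(* Main.v *)
Require Import Defs.
From HB Require Import structures.
From mathcomp Require Import all_boot all_order all_algebra.
From mathcomp Require Import perm zify ring lra.
From mathcomp Require Import all_classical all_reals all_analysis.
From mathcomp Require Import measurable_realfun.

(* Complete A by unit rows to an invertible matrix with rows B (the Y-rows and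
   the added ones) and Z.  Its determinant is a nonzero integer, so the map
   x |-> (Bx, Zx) does not increase volumes; the first bound follows since Bx
   stays in [-n, n]^(n-k), the densities are at most phi, and each fibre over Bx
   of the event is a cube of volume eps^k.

   If the densities are quasiconcave, the layer-cake formula writes the joint
   density as a superposition of indicators of boxes.  For x in a box, the fibre
   of B through x meets the box in a polytope, and a vertex of it has n - p
   coordinates at endpoints of the box, where p = n - k, while the columns S of
   B indexed by the remaining coordinates form a basis.  So Bx lies in one of
   the 2^k translates of B_S(prod_{j in S} I_j), and x |-> (B_S^-1 B x, Z x)
   maps the corresponding part of the event to a product of the intervals I_j,
   j in S, with cubes.  This costs a factor |det B_S| <= p!, and C(n, p) p! <= n^p.
   Integrating over the levels, the lengths of the I_j integrate to 1 for j in S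
   and every other coordinate contributes phi. *)

Set Implicit Arguments.
Unset Strict Implicit.
Unset Printing Implicit Defensive.

Import Order.TTheory GRing.Theory Num.Theory.
Import numFieldNormedType.Exports.

Local Open Scope classical_set_scope.
Local Open Scope ring_scope.

(** * Determinants, bases and vertices *)

Section det_bounds.
Context {R : realFieldType}.

Lemma det_le_fact p (M : 'M[R]_p) :
  (forall i j, `|M i j| <= 1) -> `|\det M| <= p`!%:R.
Proof.
move=> M1; apply: le_trans (ler_norm_sum _ _ _) _.
have <- : \sum_(s : 'S_p) 1 = p`!%:R :> R by rewrite sumr_const card_Sn.
apply: ler_sum => s _; rewrite normrM normr_sign mul1r normr_prod.
by apply: prodr_ile1 => i _; rewrite normr_ge0 M1.
Qed.

Lemma det_ge1 (K : archiRealFieldType) n (M : 'M[K]_n) :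
  (forall i j, M i j \is a Num.int) -> M \in unitmx -> 1 <= `|\det M|.
Proof.
move=> Mint; rewrite unitmxE unitfE; apply: norm_intr_ge1.
by apply: rpred_sum => s _; apply: rpredM;
    rewrite ?rpredX ?rpredN1 // rpred_prod.
Qed.

Lemma bin_fact_le n p : ('C(n, p) * p`! <= n ^ p)%N.
Proof.
rewrite bin_ffact; elim: p => [|p IH] //.
by rewrite ffactnSr expnSr leq_mul ?leq_subr.
Qed.

End det_bounds.

Section completion.
Context {F : fieldType}.

Lemma row_free_complete m n q (A : 'M[F]_(m, n)) : row_free A ->
    (m + q <= n)%N ->
  exists w : 'I_q -> 'I_n,
    (m + q <= \rank (A + \matrix_(i < q) (delta_mx ord0 (w i) : 'rV_n))%MS)%N.
Proof.
move=> Af; elim: q => [|q IH] mqn.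
  exists (fun i : 'I_0 => False_rect _ (notF (valP i))).
  by rewrite addn0 -{1}(eqP Af) mxrankS// addsmxSl.
have [|w rw] := IH; first by apply: leq_trans mqn; rewrite leq_add2l.
set W := \matrix_(i < q) _ in rw.
have n0 : (0 < n)%N by apply: leq_trans mqn; rewrite addnS.
have [i0 i0P] : exists i : 'I_n, ((delta_mx ord0 i : 'rV_n) <= A + W)%MS ->
    (n <= \rank (A + W)%MS)%N.
  have [i iP|dAW] := pickP (fun i : 'I_n =>
      ~~ ((delta_mx ord0 i : 'rV_n) <= A + W)%MS).
    by exists i; rewrite (negbTE iP).
  exists (Ordinal n0) => _; rewrite -[leqLHS](mxrank1 F n); apply: mxrankS.
  by apply/row_subP => i; rewrite row1; move/negbFE: (dAW i).
pose w' (i : 'I_q.+1) := if unlift ord_max i is Some j then w j else i0.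
exists w'; set W' := \matrix_(i < q.+1) _.
have WW' : (W <= W')%MS.
  apply/row_subP => i; rewrite rowK.
  by rewrite (_ : delta_mx _ _ = row (lift ord_max i) W') ?row_sub// rowK /w'
      liftK.
have i0W' : ((delta_mx ord0 i0 : 'rV_n) <= W')%MS.
  by rewrite (_ : delta_mx _ _ = row ord_max W') ?row_sub// rowK /w'
      unlift_none.
have AWW' : (A + W <= A + W')%MS by exact: addsmxS.
have [dAW|dAW] := boolP ((delta_mx ord0 i0 : 'rV_n) <= A + W)%MS.
  apply: leq_trans mqn _; apply: leq_trans (i0P dAW) _; exact: mxrankS.
rewrite addnS; apply: leq_ltn_trans rw _; rewrite rank_ltmx// /ltmx AWW'/=.
apply: contra dAW => AW'; apply: submx_trans AW'.
exact: submx_trans i0W' (addsmxSr _ _).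
Qed.

End completion.

Section vertex.
Context {R : realFieldType}.

Lemma kernel_supported p n (B : 'M[R]_(p, n)) (K : {set 'I_n}) :
  (p < #|~: K|)%N ->
  exists v : 'cV[R]_n, [/\ v != 0, B *m v = 0 & forall j, j \in K -> v j 0 = 0].
Proof.
move=> pK; pose g (i : 'I_#|~: K|) : 'I_n := enum_val i.
pose C : 'M[R]_(#|~: K|, p) := \matrix_(i, j) B j (g i).
have : kermx C != 0.
  rewrite kermx_eq0 /row_free neq_ltn (leq_ltn_trans (rank_leq_col C))//.
move=> /rowV0Pn[u /sub_kermxP uC u0].
pose v : 'cV[R]_n := \col_j \sum_(i | g i == j) u 0 i.
have vg i : v (g i) 0 = u 0 i.
  rewrite mxE (big_pred1 i)// => i'; rewrite /= (inj_eq _)//; exact: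
      enum_val_inj.
exists v; split.
- apply: contra u0 => /eqP v0; apply/eqP/rowP => i.
  by rewrite -vg v0 !mxE.
- apply/colP => j; rewrite mxE [RHS]mxE.
  transitivity ((u *m C) 0 j); last by rewrite uC mxE.
  rewrite mxE (eq_bigr (fun k => \sum_(i | g i == k) B j k * u 0 i));
      last first.
    by move=> k _; rewrite mxE mulr_sumr.
  rewrite (exchange_big_dep predT)//=; apply: eq_bigr => i _.
  by rewrite (big_pred1 (g i)) ?mxE 1?mulrC// => k; rewrite eq_sym.
- move=> j jK; rewrite mxE big_pred0// => i; apply/eqP => gij.
  by have := enum_valP i; rewrite -/(g i) gij inE jK.
Qed.

Section fibre.
Variables (p n : nat) (B : 'M[R]_(p, n)) (a b : 'I_n -> R).

Definition spans_off (K : {set 'I_n}) :=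
  forall u : 'rV[R]_p, (forall j, j \notin K -> (u *m B) 0 j = 0) -> u = 0.

Definition in_box (x : 'cV[R]_n) := forall j, a j <= x j 0 <= b j.

(* Move along a kernel vector v of B vanishing on K until a coordinate j with
   v_j != 0 first reaches an endpoint;
       column j of B is then a combination of the
   columns outside K, so those outside j |: K still span. *)
Lemma fix_coordinate (K : {set 'I_n}) (x : 'cV[R]_n) :
  (p < #|~: K|)%N -> spans_off K -> in_box x ->
  exists j (y : 'cV[R]_n), [/\ j \notin K, spans_off (j |: K), in_box y,
    B *m y = B *m x & (y j 0 = a j \/ y j 0 = b j) /\
      (forall i, i \in K -> y i 0 = x i 0)].
Proof.
move=> pK sK xbox; have [v [v0 Bv vK]] := kernel_supported B pK.
pose t j : R := if 0 < v j 0 then (b j - x j 0) / v j 0 else (a j - x j 0) / v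
    j 0.
have [j0 vj0] : exists j, v j 0 != 0.
  by apply/existsP; apply: contraNT v0; rewrite negb_exists => /forallP v0;
    apply/eqP/colP => j; rewrite mxE; have := v0 j; rewrite negbK => /eqP.
have t0 j : v j 0 != 0 -> 0 <= t j.
  rewrite /t => vj; have /andP[aj bj] := xbox j.
  case: ltP => vj'; first by apply: divr_ge0; rewrite ?subr_ge0 ?(ltW vj').
  by rewrite -mulrNN -invrN mulr_ge0 ?invr_ge0 ?oppr_ge0// subr_le0.
case: (@Order.TotalTheory.arg_minP _ _ _ j0 (fun j => v j 0 != 0) t vj0) =>
    j vj tmin.
pose y := x + t j *: v.
have yE i : y i 0 = x i 0 + t j * v i 0 by rewrite !mxE.
exists j, y; split.
- by apply: contra vj => /vK ->.
- move=> u uK; apply: sK => i iK; have [->|ij] := eqVneq i j; last first.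
    by apply: uK; rewrite !inE negb_or ij.
  have : (u *m B *m v) 0 0 = 0 by rewrite -mulmxA Bv mulmx0 mxE.
  rewrite mxE (bigD1 j)//= big1 ?addr0 => [|i' i'j].
    by move/eqP; rewrite mulf_eq0 (negbTE vj) orbF => /eqP.
  have [i'K|i'K] := boolP (i' \in K); first by rewrite vK// mulr0.
  by rewrite uK ?mul0r// !inE negb_or i'j.
- move=> i; rewrite yE; have /andP[ai bi] := xbox i.
  have [->|vi] := eqVneq (v i 0) 0; first by rewrite mulr0 addr0 ai.
  have tj0 := t0 j vj; have := tmin i vi; rewrite {2}/t.
  case: ltP => vi'.
    by rewrite ler_pdivlMr// => h; apply/andP; split; [nra|lra].
  have vi'' : v i 0 < 0 by rewrite lt_neqAle vi.
  by rewrite ler_ndivlMr// => h; apply/andP; split; [lra|nra].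
- by rewrite mulmxDr -scalemxAr Bv scaler0 addr0.
- split; last by move=> i iK; rewrite yE vK// mulr0 addr0.
  rewrite yE /t; case: ifP => _; [right|left]; rewrite divfK// addrC subrK//.
Qed.

Lemma exists_vertex (x : 'cV[R]_n) : row_free B -> in_box x ->
  exists (S : {set 'I_n}) (y : 'cV[R]_n),
    [/\ #|S| = p, spans_off (~: S), in_box y, B *m y = B *m x &
        forall j, j \notin S -> y j 0 = a j \/ y j 0 = b j].
Proof.
move=> Bf xbox.
have pn : (p <= n)%N by rewrite -(eqP Bf) rank_leq_col.
suff /(_ (n - p)%N (leqnn _)) : forall q, (q <= n - p)%N ->
    exists (K : {set 'I_n}) (y : 'cV[R]_n),
    [/\ #|K| = q, spans_off K, in_box y, B *m y = B *m x &
        forall j, j \in K -> y j 0 = a j \/ y j 0 = b j].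
  move=> [K [y [cK sK yb By yK]]]; exists (~: K), y; split => //.
  - by rewrite cardsCs finset.setCK card_ord cK subKn.
  - by rewrite finset.setCK.
  - by move=> j; rewrite inE negbK; exact: yK.
elim=> [_|q IH qn].
  exists finset.set0, x; split => //; first by rewrite cards0.
    move=> u u0; apply: (row_free_inj Bf); rewrite mul0mx.
    by apply/rowP => j; rewrite u0 ?inE// mxE.
  by move=> j; rewrite inE.
have [K [y [cK sK yb By yK]]] := IH (ltnW qn).
have pK : (p < #|~: K|)%N by rewrite cardsCs finset.setCK card_ord cK; lia.
have [j [z [jK sjK zb Bz [zj zK]]]] := fix_coordinate pK sK yb.
exists (j |: K), z; split => //.
- by rewrite cardsU1 jK cK.
- by rewrite Bz.
- move=> i; rewrite !inE => /predU1P[->//|iK]; rewrite zK//; exact: yK.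
Qed.

End fibre.

Definition cols n p (i0 : 'I_n) (S : {set 'I_n}) (i : 'I_p) : 'I_n :=
  nth i0 (enum S) i.

Lemma cols_in n p (i0 : 'I_n) (S : {set 'I_n}) (i : 'I_p) : #|S| = p ->
    cols i0 S i \in S.
Proof. by move=> cS; rewrite -mem_enum mem_nth// -cardE cS. Qed.

Lemma colsP n p (i0 : 'I_n) (S : {set 'I_n}) j : #|S| = p -> j \in S ->
  exists i : 'I_p, j = cols i0 S i.
Proof.
move=> cS jS; have lt : (index j (enum S) < p)%N by rewrite -cS cardE index_mem
    mem_enum.
by exists (Ordinal lt); rewrite /cols nth_index// mem_enum.
Qed.

Lemma big_cols (T : Type) (idx : T) (op : Monoid.com_law idx) n p (i0 : 'I_n)
    (S : {set 'I_n}) (h : 'I_n -> T) : #|S| = p ->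
  \big[op/idx]_(i < p) h (cols i0 S i) = \big[op/idx]_(j in S) h j.
Proof.
by move=> cS; rewrite -(big_enum _ _ S) (big_nth i0) -cardE cS big_mkord.
Qed.

Lemma colsub_unit n p (B : 'M[R]_(p, n)) (i0 : 'I_n) (S : {set 'I_n}) :
  #|S| = p -> spans_off B (~: S) -> colsub (@cols n p i0 S) B \in unitmx.
Proof.
move=> cS sS; rewrite -row_free_unit -kermx_eq0; apply: contraT =>
    /rowV0Pn[u uk u0].
case/eqP: u0; apply: sS => j; rewrite inE negbK => /(colsP i0 cS)[i ->].
move/sub_kermxP: uk => /(congr1 (fun M : 'rV_p => M 0 i));
    rewrite [LHS]mxE [RHS]mxE => h.
by rewrite mxE -[RHS]h; apply: eq_bigr => l _; rewrite [in RHS]mxE.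
Qed.

End vertex.

(** * Iterated integrals over tuples *)

Section affine.
Context {R : realType}.
Local Open Scope ereal_scope.
Local Notation leb := (@lebesgue_measure R).

Definition affine (a b x : R) : R := (a * x + b)%R.

Lemma measurable_affine (a b : R) : measurable_fun setT (affine a b).
Proof. by apply: measurable_funD => //; exact: measurable_funM. Qed.

Lemma lebesgue_measure_affine (a b : R) (A : set R) : a != 0%R ->
  measurable A -> leb A = `|a|%:E * leb (affine a b @^-1` A).
Proof.
move=> a0 mA.
have mphi : measurable_fun setT (affine a b : measurableTypeR R ->
    measurableTypeR R).
  exact: measurable_affine.
pose m : {measure set (measurableTypeR R) -> \bar R} :=
  mscale (NngNum (normr_ge0 a)) (pushforward leb
      (affine a b : measurableTypeR R -> measurableTypeR R)).
suff mE X : ocitv X -> leb X = m mphi X by exact: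
    (lebesgue_measure_unique mE mA).
move=> [[l r] /= _ <-].
rewrite /m /= /mscale /= /pushforward /=.
have [a_lt0|a_gt0|] := ltgtP a 0%R; last by move/eqP; rewrite (negbTE a0).
- have -> : affine a b @^-1` `]l, r]%classic =
    [set` Interval (BLeft ((r - b) / a)%R) (BLeft ((l - b) / a)%R)].
    by apply/seteqP; split => x /=; rewrite /affine !in_itv/=
        ler_ndivrMr ?ltr_ndivlMr // => /andP[? ?]; apply/andP; split; lra.
  rewrite !lebesgue_measure_itv/= !lte_fin ltr_ndivrMr// divfK// ltrD2r.
  case: ifPn => _; last by rewrite mule0.
  rewrite -!EFinB -EFinM; congr EFin; rewrite ltr0_norm//; field; exact: a0.
- have -> : affine a b @^-1` `]l, r]%classic =
    [set` Interval (BRight ((l - b) / a)%R) (BRight ((r - b) / a)%R)].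
    by apply/seteqP; split => x /=; rewrite /affine !in_itv/=
        ltr_pdivrMr ?ler_pdivlMr // => /andP[? ?]; apply/andP; split; lra.
  rewrite !lebesgue_measure_itv/= !lte_fin ltr_pdivrMr// divfK// ltrD2r.
  case: ifPn => _; last by rewrite mule0.
  rewrite -!EFinB -EFinM; congr EFin; rewrite gtr0_norm//; field; exact: a0.
Qed.

Lemma integral_affine (a b : R) (f : R -> \bar R) : a != 0%R ->
  measurable_fun setT f -> (forall x, 0 <= f x) ->
  \int[leb]_x f x = `|a|%:E * \int[leb]_x f (affine a b x).
Proof.
move=> a0 mf f0.
have mphi : measurable_fun setT (affine a b : measurableTypeR R ->
    measurableTypeR R).
  exact: measurable_affine.
pose m : {measure set (measurableTypeR R) -> \bar R} :=
  mscale (NngNum (normr_ge0 a)) (pushforward leb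
      (affine a b : measurableTypeR R -> measurableTypeR R)).
transitivity (\int[m mphi]_x f x).
  apply: eq_measure_integral => A mA _.
  exact: (lebesgue_measure_affine b a0 mA).
rewrite ge0_integral_mscale//= ge0_integral_pushforward//=.
Qed.
End affine.

Section iterated.
Context {R : realType}.
Local Open Scope ereal_scope.
Local Notation leb := (@lebesgue_measure R).

Fixpoint iint (n : nat) : (n.-tuple R -> \bar R) -> \bar R :=
  match n with
  | 0 => fun F => F [tuple]
  | n'.+1 => fun F => \int[leb]_x iint (fun t => F [tuple of x :: t])
  end.

Lemma eq_iint n (F G : n.-tuple R -> \bar R) : F =1 G -> iint F = iint G.
Proof. by move=> /funext->. Qed.

Lemma iint_ge0 n (F : n.-tuple R -> \bar R) :
  (forall t, 0 <= F t) -> 0 <= iint F.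
Proof.
elim: n F => [|n IH] F F0 /=; first exact: F0.
by apply: integral_ge0 => x _; exact: IH.
Qed.

Lemma measurable_cons_pair n :
  measurable_fun setT (fun p : R * n.-tuple R => [tuple of p.1 :: p.2]).
Proof. exact: measurable_cons. Qed.

Lemma measurable_iint n d (T : measurableType d)
    (F : T -> n.-tuple R -> \bar R) :
  measurable_fun setT (fun p : T * n.-tuple R => F p.1 p.2) ->
  (forall x t, 0 <= F x t) ->
  measurable_fun setT (fun x => iint (F x)).
Proof.
elim: n d T F => [|n IH] d T F mF F0 /=.
  by apply: (measurableT_comp mF (g := fun x => (x, [tuple]))); exact:
      measurable_fun_pair.
apply: (@measurable_fun_fubini_tonelli_F _ _ _ (measurableTypeR R) R
  leb (fun p => iint (fun t => F p.1 [tuple of p.2 :: t]))).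
- apply: (IH _ _ (fun (p : T * measurableTypeR R) t =>
    F p.1 [tuple of p.2 :: t])).
  + apply: (measurableT_comp mF (g := fun q :
      (T * measurableTypeR R) * n.-tuple R =>
          (q.1.1, [tuple of q.1.2 :: q.2]))).
    apply: measurable_fun_pair => /=; first exact: measurableT_comp.
    apply: measurable_cons => //; exact: measurableT_comp.
  + by move=> *; exact: F0.
- by move=> p; exact: iint_ge0.
Qed.

Section consF.
Variables (n : nat) (F : n.+1.-tuple R -> \bar R).
Hypotheses (mF : measurable_fun setT F) (F0 : forall t, 0 <= F t).

Lemma measurable_slice x : measurable_fun setT
    (fun t : n.-tuple R => F [tuple of x :: t]).
Proof. by apply: measurableT_comp mF _; exact: measurable_cons. Qed.

Lemma measurable_slice_pair :
  measurable_fun setT (fun p : measurableTypeR R * n.-tuple R =>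
      F [tuple of p.1 :: p.2]).
Proof. by apply: measurableT_comp mF _; exact: measurable_cons. Qed.

Lemma measurable_iint_slice :
  measurable_fun setT (fun x : measurableTypeR R =>
      iint (fun t => F [tuple of x :: t])).
Proof.
by apply: (measurable_iint (F := fun (x : measurableTypeR R) (t : n.-tuple R)
    => F [tuple of x :: t])) => //; exact: measurable_slice_pair.
Qed.
End consF.

Lemma le_iint n (F G : n.-tuple R -> \bar R) :
  measurable_fun setT F -> measurable_fun setT G ->
  (forall t, 0 <= F t) -> (forall t, F t <= G t) -> iint F <= iint G.
Proof.
elim: n F G => [|n IH] F G mF mG F0 FG /=; first exact: FG.
have G0 t : 0 <= G t by exact: le_trans (FG t).
apply: ge0_le_integral => //.
- by move=> x _; exact: iint_ge0.
- exact: measurable_iint_slice.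
- exact: measurable_iint_slice.
- by move=> x _; apply: IH => //; exact: measurable_slice.
Qed.

Lemma iint_sum n (I : Type) (s : seq I) (F : I -> n.-tuple R -> \bar R) :
  (forall i, measurable_fun setT (F i)) -> (forall i t, 0 <= F i t) ->
  iint (fun t => \sum_(i <- s) F i t) = \sum_(i <- s) iint (F i).
Proof.
elim: n F => [|n IH] F mF F0 //=.
under eq_integral.
  move=> x _; rewrite IH//; last by move=> i; exact: measurable_slice.
  over.
rewrite ge0_integral_sum//.
- by move=> i; exact: measurable_iint_slice.
- by move=> i x _; exact: iint_ge0.
Qed.

Lemma iintZl n (c : \bar R) (F : n.-tuple R -> \bar R) :
  measurable_fun setT F -> (forall t, 0 <= F t) -> 0 <= c ->
  iint (fun t => c * F t) = c * iint F.
Proof.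
elim: n F => [|n IH] F mF F0 c0 //=.
under eq_integral.
  move=> x _; rewrite IH//; last exact: measurable_slice.
  over.
rewrite ge0_integralZl//; first exact: measurable_iint_slice.
by move=> x _; exact: iint_ge0.
Qed.

Lemma integral_iint_swap n d (T : measurableType d)
    (m : {sigma_finite_measure set T -> \bar R})
        (F : T -> n.-tuple R -> \bar R) :
  measurable_fun setT (fun p : T * n.-tuple R => F p.1 p.2) ->
  (forall x t, 0 <= F x t) ->
  \int[m]_x iint (F x) = iint (fun t => \int[m]_x F x t).
Proof.
elim: n F => [|n IH] F mF F0 //=.
have mF' : measurable_fun setT
    (fun q : (T * measurableTypeR R) * n.-tuple R =>
        F q.1.1 [tuple of q.1.2 :: q.2]).
  apply: (measurableT_comp mF (g := fun q :
      (T * measurableTypeR R) * n.-tuple R =>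
          (q.1.1, [tuple of q.1.2 :: q.2]))).
  apply: measurable_fun_pair => /=; first exact: measurableT_comp.
  by apply: measurable_cons => //; exact: measurableT_comp.
have := @fubini_tonelli _ _ _ _ _ m leb
  (fun p : T * measurableTypeR R => iint (fun t => F p.1 [tuple of p.2 :: t])).
rewrite /= => ->; last 2 first.
- exact: (measurable_iint (F := fun (p : T * measurableTypeR R) t =>
    F p.1 [tuple of p.2 :: t])).
- by move=> p; exact: iint_ge0.
apply: eq_integral => x _; rewrite IH//.
apply: (measurableT_comp mF' (g := fun q : T * n.-tuple R => ((q.1, x), q.2))).
by repeat apply: measurable_fun_pair => //=.
Qed.

Lemma iint_swap n p (F : n.-tuple R -> p.-tuple R -> \bar R) :
  measurable_fun setT (fun q : n.-tuple R * p.-tuple R => F q.1 q.2) ->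
  (forall x t, 0 <= F x t) ->
  iint (fun x => iint (F x)) = iint (fun t => iint (F ^~ t)).
Proof.
elim: n F => [|n IH] F mF F0 //=.
have mF' : measurable_fun setT (fun q :
    (measurableTypeR R * p.-tuple R) * n.-tuple R =>
    F [tuple of q.1.1 :: q.2] q.1.2).
  apply: (measurableT_comp mF (g := fun q :
      (measurableTypeR R * p.-tuple R) * n.-tuple R =>
          ([tuple of q.1.1 :: q.2], q.1.2))).
  apply: measurable_fun_pair => /=; last exact: measurableT_comp.
  by apply: measurable_cons => //; exact: measurableT_comp.
under eq_integral.
  move=> x _; rewrite IH//; last first.
    apply: (measurableT_comp mF' (g := fun q : n.-tuple R * p.-tuple R =>
        ((x, q.2), q.1))).
    by repeat apply: measurable_fun_pair => //=.
  over.
rewrite integral_iint_swap//.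
- exact: (measurable_iint (F := fun (q : measurableTypeR R * p.-tuple R) t =>
    F [tuple of q.1 :: t] q.2)).
- by move=> x t; exact: iint_ge0.
Qed.

Lemma emeasurable_prod d (T : measurableType d) (I : Type) (s : seq I)
    (P : pred I) (h : I -> T -> \bar R) :
  (forall i, measurable_fun setT (h i)) ->
  measurable_fun setT (fun x => \prod_(i <- s | P i) h i x).
Proof.
move=> mh; elim: s => [|i s IH].
  by under eq_fun do rewrite big_nil; exact: measurable_cst.
under eq_fun do rewrite big_cons.
by case: (P i) => //; exact: emeasurable_funM.
Qed.

Lemma measurable_prod_tnth n (h : 'I_n -> R -> \bar R) :
  (forall i, measurable_fun setT (h i)) ->
  measurable_fun setT (fun t : n.-tuple R => \prod_(i < n) h i (tnth t i)).
Proof.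
move=> mh; apply: emeasurable_prod => i.
by apply: measurableT_comp (mh i) _; exact: measurable_tnth.
Qed.

Lemma iint_prod n (h : 'I_n -> R -> \bar R) :
  (forall i, measurable_fun setT (h i)) -> (forall i x, 0 <= h i x) ->
  iint (fun t => \prod_(i < n) h i (tnth t i)) =
      \prod_(i < n) \int[leb]_x h i x.
Proof.
elim: n h => [|n IH] h mh h0 /=; first by rewrite !big_ord0.
under eq_integral.
  move=> x _.
  under eq_iint.
    move=> t; rewrite big_ord_recl tnth0.
    under eq_bigr do rewrite tnthS.
    over.
  rewrite iintZl//; last 2 first.
    exact: (measurable_prod_tnth (h := fun i => h (lift ord0 i))).
    by move=> t; apply: (@prode_ge0 R) => i _.
  rewrite (IH (fun i => h (lift ord0 i)))//.
  over.
rewrite ge0_integralZr//=; first by rewrite big_ord_recl.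
  exact: mh.
by apply: (@prode_ge0 R) => i _; apply: integral_ge0.
Qed.

Lemma iint_cat p k (F : (p + k).-tuple R -> \bar R) :
  iint F = iint (fun u : p.-tuple R =>
      iint (fun z : k.-tuple R => F [tuple of u ++ z])).
Proof.
elim: p F => [|p IH] F /=.
  by apply: eq_iint => t; congr F; exact/val_inj.
apply: eq_integral => x _; rewrite IH.
by apply: eq_iint => u; apply: eq_iint => z; congr F; exact/val_inj.
Qed.

End iterated.

(** * Linear change of variables *)

Section linmap.
Context {R : realType}.

Definition tuple_col n (t : n.-tuple R) : 'cV[R]_n := \col_i tnth t i.
Definition col_tuple n (v : 'cV[R]_n) : n.-tuple R := [tuple v i 0 | i < n].
Definition linmap m n (M : 'M[R]_(m, n)) (t : n.-tuple R) : m.-tuple R :=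
  col_tuple (M *m tuple_col t).

Lemma tuple_colK n : cancel (@tuple_col n) (@col_tuple n).
Proof. by move=> t; apply: eq_from_tnth => i; rewrite tnth_mktuple mxE. Qed.

Lemma col_tupleK n : cancel (@col_tuple n) (@tuple_col n).
Proof. by move=> v; apply/colP => i; rewrite mxE tnth_mktuple. Qed.

Lemma tnth_linmap m n (M : 'M[R]_(m, n)) t i :
  tnth (linmap M t) i = \sum_j M i j * tnth t j.
Proof. by rewrite tnth_mktuple mxE; apply: eq_bigr => j _; rewrite mxE. Qed.

Lemma tuple_col_linmap m n (M : 'M[R]_(m, n)) t : tuple_col (linmap M t) =
    M *m tuple_col t.
Proof. exact: col_tupleK. Qed.

Lemma linmapM m n p (M : 'M[R]_(m, n)) (N : 'M[R]_(n, p)) t :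
  linmap (M *m N) t = linmap M (linmap N t).
Proof. by rewrite {2}/linmap tuple_col_linmap mulmxA. Qed.

Lemma measurable_linmap m n (M : 'M[R]_(m, n)) : measurable_fun setT (linmap M).
Proof.
apply/measurable_fun_tnthP => i.
rewrite (_ : _ \o _ = fun t => \sum_j M i j * tnth t j); last first.
  by apply/funext => t /=; rewrite tnth_linmap.
apply: measurable_sum => j; apply: measurable_funM => //.
exact: measurable_tnth.
Qed.

Lemma tuple_col_cat p k (u : p.-tuple R) (z : k.-tuple R) :
  tuple_col [tuple of u ++ z] = col_mx (tuple_col u) (tuple_col z).
Proof.
apply/colP => i; rewrite mxE; case: (splitP i) => j ij.
  rewrite (_ : i = lshift k j); last exact/val_inj.
  by rewrite col_mxEu mxE (tnth_nth 0) /= nth_cat size_tuple ltn_ord -tnth_nth.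
rewrite (_ : i = rshift p j); last exact/val_inj.
rewrite col_mxEd mxE (tnth_nth 0) /= nth_cat size_tuple.
by rewrite ltnNge leq_addr /= addKn -tnth_nth.
Qed.

Lemma col_tuple_col_mx p k (u : 'cV[R]_p) (z : 'cV[R]_k) :
  col_tuple (col_mx u z) = [tuple of col_tuple u ++ col_tuple z].
Proof. by rewrite -(tuple_colK [tuple of _ ++ _]) tuple_col_cat !col_tupleK.
    Qed.

Lemma linmap_col_mx p k n (B : 'M[R]_(p, n)) (Z : 'M[R]_(k, n)) t :
  linmap (col_mx B Z) t = [tuple of linmap B t ++ linmap Z t].
Proof. by rewrite /linmap mul_col_mx col_tuple_col_mx. Qed.

Lemma tuple_col_cons n x (t : n.-tuple R) :
  tuple_col [tuple of x :: t] = col_mx (x%:M : 'cV_1) (tuple_col t) :>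
      'cV_(1 + n).
Proof.
transitivity (tuple_col [tuple of [tuple x] ++ t] : 'cV_(1 + n)).
  by congr (tuple_col _ : 'cV_(1 + n)); exact/val_inj.
rewrite (tuple_col_cat [tuple x] t); congr col_mx.
by apply/colP => i; rewrite !mxE (tnth_nth 0) ord1.
Qed.

Lemma col_tuple_cons n x (v : 'cV[R]_n) :
  col_tuple (col_mx (x%:M : 'cV_1) v) = [tuple of x :: col_tuple v].
Proof. by rewrite -(tuple_colK [tuple of x :: _]) tuple_col_cons col_tupleK.
    Qed.

Lemma col_tuple_add_cons n x y (t u : n.-tuple R) :
  col_tuple (tuple_col [tuple of x :: t] + tuple_col [tuple of y :: u]) =
  [tuple of x + y :: col_tuple (tuple_col t + tuple_col u)].
Proof.
apply: eq_from_tnth => i; rewrite tnth_mktuple !mxE.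
by case: (unliftP ord0 i) => [j|] ->; rewrite ?tnthS ?tnth0 // tnth_mktuple
    !mxE.
Qed.

End linmap.

Section change_of_variables.
Context {R : realType}.
Local Open Scope ereal_scope.
Local Notation leb := (@lebesgue_measure R).

Lemma iint_translate n (b : n.-tuple R) (F : n.-tuple R -> \bar R) :
  measurable_fun setT F -> (forall t, 0 <= F t) ->
  iint (fun t => F (col_tuple (tuple_col t + tuple_col b)%R)) = iint F.
Proof.
elim: n b F => [|n IH] b F mF F0.
  by congr F; apply: eq_from_tnth => -[].
have {1}-> : b = [tuple of thead b :: behead_tuple b].
  by rewrite [LHS]tuple_eta; exact/val_inj.
rewrite [LHS]/=.
under eq_integral.
  move=> x _.
  under eq_iint.
    move=> t; rewrite col_tuple_add_cons.
    over.
  rewrite (IH _ (fun t : n.-tuple R => F [tuple of (x + thead b)%R :: t]))//;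
      last first.
    exact: measurable_slice.
  over.
rewrite [RHS](@integral_affine _ 1%R (thead b)) ?oner_eq0//; last 2 first.
  exact: measurable_iint_slice.
  by move=> x; exact: iint_ge0.
by rewrite normr1 mul1e; apply: eq_integral => x _; rewrite /affine mul1r.
Qed.

Definition det_scales n (M : 'M[R]_n) := forall F : n.-tuple R -> \bar R,
  measurable_fun setT F -> (forall t, 0 <= F t) ->
  iint F = `|\det M|%:E * iint (F \o linmap M).

Lemma det_scales_mul n (M N : 'M[R]_n) :
  det_scales M -> det_scales N -> det_scales (M *m N).
Proof.
move=> sM sN F mF F0; rewrite (sM F mF F0).
have mFM : measurable_fun setT (F \o linmap M).
  by apply: measurableT_comp mF _; exact: measurable_linmap.
rewrite (sN (F \o linmap M) mFM)//; last by move=> t; exact: F0.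
rewrite muleA -EFinM -normrM -det_mulmx; congr (_ * _).
by apply: eq_iint => t /=; rewrite linmapM.
Qed.

Lemma det_scales_upper n (a : R) (c : 'rV[R]_n) : a != 0%R ->
  det_scales (block_mx (a%:M : 'M[R]_1) c 0 1%:M : 'M[R]_(1 + n)).
Proof.
move=> a0 F mF F0.
rewrite det_ublock det1 mulr1 det_scalar1 [LHS]/= [X in _ * X]/=.
have linE x (t : n.-tuple R) : linmap (block_mx (a%:M : 'M[R]_1) c 0 1%:M)
    [tuple of x :: t] =
    [tuple of affine a ((c *m tuple_col t) 0 0)%R x :: t].
  rewrite /linmap tuple_col_cons mul_block_col mul0mx add0r mul1mx -scalar_mxM.
  by rewrite [(c *m tuple_col t)%R in LHS]mx11_scalar -raddfD/=
      col_tuple_cons tuple_colK.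
rewrite (@integral_iint_swap _ _ _ _ leb
    (fun x (t : n.-tuple R) => F [tuple of x :: t]))//; last first.
  exact: measurable_slice_pair.
have mG : measurable_fun setT (fun p : measurableTypeR R * n.-tuple R =>
    F (linmap (block_mx (a%:M : 'M[R]_1) c 0 1%:M) [tuple of p.1 :: p.2])).
  apply: (measurable_slice_pair (F := fun t => F (linmap _ t))).
  by apply: measurableT_comp mF _; exact: measurable_linmap.
rewrite (@integral_iint_swap _ _ _ _ leb
    (fun x (t : n.-tuple R) => F (linmap (block_mx (a%:M : 'M[R]_1) c 0 1%:M)
        [tuple of x :: t])))//.
rewrite -iintZl//; last 2 first.
- pose f (p : n.-tuple R * measurableTypeR R) :=
    F (linmap (block_mx (a%:M : 'M[R]_1) c 0 1%:M) [tuple of p.2 :: p.1]).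
  apply: (@measurable_fun_fubini_tonelli_F _ _ _ (measurableTypeR R) R leb f)
      => //.
    apply: (measurableT_comp mG (g := fun q : n.-tuple R * measurableTypeR R =>
        (q.2, q.1))).
    exact: measurable_fun_pair.
  by move=> p; exact: F0.
- by move=> t; apply: integral_ge0 => x _; exact: F0.
apply: eq_iint => t; rewrite (@integral_affine _ a
    ((c *m tuple_col t) 0 0)%R)//; last first.
  by apply: (measurableT_comp mF (g := fun x : R => [tuple of x :: t])); exact:
      measurable_cons.
by congr (_ * _); apply: eq_integral => x _; rewrite linE.
Qed.

Lemma det_scales_lower n (r : 'cV[R]_n) (N : 'M[R]_n) : det_scales N ->
  det_scales (block_mx (1%:M : 'M[R]_1) 0 r N : 'M[R]_(1 + n)).
Proof.
move=> sN F mF F0.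
rewrite det_lblock det1 mul1r [LHS]/= [X in _ * X]/=.
have linE x (t : n.-tuple R) : linmap (block_mx (1%:M : 'M[R]_1) 0 r N)
    [tuple of x :: t] =
    [tuple of x :: col_tuple (tuple_col (linmap N t) + tuple_col
        (col_tuple (x *: r)))%R].
  rewrite /linmap tuple_col_cons mul_block_col mul0mx addr0 mul1mx.
  by rewrite col_tuple_cons !col_tupleK mul_mx_scalar addrC.
have mG : measurable_fun setT (F \o linmap (block_mx (1%:M : 'M[R]_1) 0 r N)).
  by apply: measurableT_comp mF _; exact: measurable_linmap.
rewrite -ge0_integralZl//; last 2 first.
- by apply: (measurable_iint_slice mG) => t; exact: F0.
- by move=> x _; exact: iint_ge0.
apply: eq_integral => x _.
rewrite -(@iint_translate _ (col_tuple (x *: r)%R))//; last exact: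
    measurable_slice.
rewrite sN//; last first.
  apply: (measurableT_comp (measurable_slice mF x)).
  apply/measurable_fun_tnthP => i.
  rewrite (_ : _ \o _ = fun t : n.-tuple R => tnth t i + (x *: r)%R i 0)%R;
      last first.
    by apply/funext => t /=; rewrite tnth_mktuple !mxE tnth_mktuple !mxE.
  by apply: measurable_funD => //; exact: measurable_tnth.
by congr (_ * _); apply: eq_iint => t; rewrite /= linE.
Qed.

Lemma iint_linmap n (M : 'M[R]_n) : M \in unitmx -> det_scales M.
Proof.
elim: n M => [|n IH]; last change (forall M : 'M[R]_(1 + n), M \in unitmx ->
    det_scales M); move=> M Mu.
  move=> F _ _; rewrite det_mx00 normr1 mul1e /=; congr F.
  by apply: eq_from_tnth => -[].
have pivot (N : 'M[R]_(1 + n)) : N \in unitmx -> N ord0 ord0 != 0%R ->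
    det_scales N.
  move=> Nu N00; set a : R := N ord0 ord0.
  pose c : 'rV[R]_n := ursubmx N; pose r : 'cV[R]_n := dlsubmx N.
  pose N' : 'M[R]_n := (drsubmx N - a^-1 *: (r *m c))%R.
  (* the factor N' is the Schur complement of the pivot a *)
  have NE : N = (block_mx (1%:M : 'M[R]_1) 0 (a^-1 *: r) N' *m block_mx
      (a%:M : 'M[R]_1) c 0 1%:M : 'M[R]_(1+n)).
    rewrite mulmx_block !mul1mx !mul0mx !mulmx0 !addr0 mulmx1.
    rewrite mul_mx_scalar scalerA mulfV// scale1r -scalemxAl /N' addrCA subrr
        addr0.
    rewrite -[LHS]submxK; congr block_mx.
    by rewrite [LHS]mx11_scalar; congr (_%:M); rewrite !mxE; congr (N _ _);
        apply/val_inj.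
  rewrite NE; apply: det_scales_mul; last exact: det_scales_upper.
  apply: det_scales_lower; apply: IH.
  move: Nu; rewrite !unitmxE NE det_mulmx det_lblock det_ublock det1 mul1r
      !unitfE.
  by rewrite mulf_eq0 negb_or => /andP[].
have [M00|M00] := eqVneq (M ord0 ord0) 0%R; last exact: pivot.
have [i Mi] : exists i : 'I_n, M (rshift 1 i) ord0 != 0%R.
  apply/existsP; apply: contraT; rewrite negb_exists => /forallP M0.
  move: Mu; rewrite unitmxE unitfE (expand_det_col _ ord0) big1 ?eqxx// => j _.
  have [->|[j' ->]] : j = ord0 \/ exists j', j = rshift 1 j'.
    by case: (unliftP ord0 j) => [j'|] ->;
        [right; exists j'; rewrite rshift1|left].
    by rewrite M00 mul0r.
  by move: (M0 j'); rewrite negbK => /eqP ->; rewrite mul0r.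
pose up (s : R) : 'M[R]_(1 + n) := block_mx (1%:M : 'M[R]_1)
    (s *: delta_mx ord0 i)%R 0%R 1%:M.
have upu s : up s \in unitmx by rewrite unitmxE det_ublock !det1 mulr1 unitr1.
have ME : M = (up (-1)%R *m (up 1%R *m M)).
  rewrite mulmxA mulmx_block !mul1mx !mul0mx !mulmx0 !addr0 !mulmx1 add0r.
  by rewrite scale1r scaleN1r subrr -scalar_mx_block mul1mx.
rewrite ME; apply: det_scales_mul; first exact: det_scales_upper (oner_neq0 _).
apply: pivot; first by rewrite unitmx_mul upu.
rewrite -[M]submxK mulmx_block !mul1mx !scale1r.
have ulE (A : 'M[R]_1) B C (D : 'M[R]_n) : block_mx A B C D ord0 ord0 =
    A ord0 ord0.
  by rewrite -(block_mxEul A B C D); congr (block_mx _ _ _ _ _ _);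
      exact/val_inj.
rewrite ulE mxE (_ : ulsubmx M ord0 ord0 = 0)%R ?add0r; last first.
  by rewrite !mxE -M00; congr (M _ _); exact/val_inj.
rewrite -rowE !mxE; move: Mi; congr (M _ _ != _); exact/val_inj.
Qed.

End change_of_variables.

(** * Laws of tuples of independent variables *)

Section law.
Context {R : realType}.
Local Open Scope ereal_scope.
Local Notation leb := (@lebesgue_measure R).

Lemma integral_layer (g : R) : (0 <= g)%R ->
  \int[leb]_t (\1_(`]0%R, g]) t)%:E = g%:E.
Proof.
move=> g0; rewrite integral_indic//= setIT lebesgue_measure_itv/= lte_fin.
case: ltP; first by rewrite EFinN sube0.
by move=> g0'; congr EFin; apply/eqP; rewrite eq_le g0 g0'.
Qed.

Definition subgraph d (T : measurableType d) (g : T -> R) : set (T * R) :=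
  [set p | (0 < p.2 <= g p.1)%R].

Lemma measurable_subgraph d (T : measurableType d) (g : T -> R) :
  measurable_fun setT g -> measurable (subgraph g).
Proof.
move=> mg; rewrite (_ : subgraph g = [set p | (0 < p.2)%R] `&`
    [set p | (p.2 <= g p.1)%R]); last first.
  by apply/seteqP; split => p /=; rewrite /subgraph/= => /andP.
apply: measurableI.
  rewrite -[X in measurable X]setTI.
  exact: (measurable_fun_ltr (f := cst 0%R) (g := snd)) measurableT [set true]
      _.
rewrite -[X in measurable X]setTI.
by apply: (measurable_fun_ler (f := snd) (g := g \o fst)) measurableT
    [set true] _ => //; exact: measurableT_comp.
Qed.

Lemma subgraph_layer d (T : measurableType d) (g : T -> R) x :
  (0 <= g x)%R -> \int[leb]_t ((\1_(subgraph g) (x, t))%:E : \bar R) = (g x)%:E.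
Proof.
move=> g0; rewrite -[RHS](integral_layer g0); apply: eq_integral => t _.
by rewrite !indicE; congr (_%:R%:E); apply/idP/idP; rewrite !inE/= in_itv.
Qed.

Lemma measurable_indic_subgraph d (T : measurableType d) (g : T -> R) :
  measurable_fun setT g ->
  measurable_fun setT (fun p : T * measurableTypeR R =>
      (\1_(subgraph g) p)%:E : \bar R).
Proof.
by move=> mg; apply/measurable_EFinP; apply: measurable_indic; exact:
    measurable_subgraph.
Qed.

Lemma integral_density (nu : {sigma_finite_measure set (measurableTypeR R) ->
    \bar R})
    (u h : R -> R) :
  measurable_fun setT u -> (forall x, (0 <= u x)%R) ->
  measurable_fun setT h -> (forall x, (0 <= h x)%R) ->
  (forall B, measurable B -> nu B = \int[leb]_(x in B) (u x)%:E) ->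
  \int[nu]_x (h x)%:E = \int[leb]_x ((u x)%:E * (h x)%:E).
Proof.
move=> mu u0 mh h0 nuE.
have mI : measurable_fun setT (fun p : measurableTypeR R * measurableTypeR R =>
    (\1_(subgraph (h : measurableTypeR R -> R)) p)%:E : \bar R).
  exact: measurable_indic_subgraph.
transitivity (\int[nu]_x \int[leb]_t ((\1_(subgraph h) (x, t))%:E : \bar R)).
  by apply: eq_integral => x _; rewrite subgraph_layer.
transitivity (\int[leb]_x \int[leb]_t ((u x)%:E *
    ((\1_(subgraph h) (x, t))%:E : \bar R))); last first.
  apply: eq_integral => x _.
  rewrite ge0_integralZl ?subgraph_layer ?lee_fin//.
    by apply: (measurableT_comp mI (g := fun t => (x, t))); exact:
        measurable_fun_pair.
have mU : measurable_fun setT (fun p : measurableTypeR R * measurableTypeR R =>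
    (u p.1)%:E * ((\1_(subgraph h) p)%:E : \bar R)).
  apply: emeasurable_funM => //; apply/measurable_EFinP.
  exact: (measurableT_comp mu).
rewrite (@fubini_tonelli _ _ _ _ _ nu leb (fun p => (\1_(subgraph h) p)%:E))//.
rewrite (@fubini_tonelli _ _ _ _ _ leb leb
    (fun p => (u p.1)%:E * (\1_(subgraph h) p)%:E))//; last by move=> p;
        rewrite mule_ge0// lee_fin.
apply: eq_integral => t _; rewrite /fubini_G/=.
have mA : measurable (ysection (subgraph h) t).
  apply: measurable_ysection.
  exact: (@measurable_subgraph _ (measurableTypeR R)).
transitivity (\int[nu]_x (\1_(ysection (subgraph h) t) x)%:E).
  by apply: eq_integral => x _; rewrite !indicE mem_ysection.
rewrite integral_indic//= setIT nuE// [LHS]integral_mkcond.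
apply: eq_integral => x _; rewrite /patch !indicE mem_ysection.
by case: ifPn => _; rewrite ?mule1 ?mule0.
Qed.

End law.

Section probability.
Context d (T : measurableType d) (R : realType) (P : probability T R).
Local Open Scope ereal_scope.
Local Notation leb := (@lebesgue_measure R).

Definition box n (B : 'I_n -> set R) : set (n.-tuple R) :=
  [set t | forall i, B i (tnth t i)].

Lemma measurable_box n (B : 'I_n -> set R) :
  (forall i, measurable (B i)) -> measurable (box B).
Proof.
move=> mB; rewrite (_ : box B = \bigcap_i
    ((fun t : n.-tuple R => tnth t i) @^-1` B i)); last first.
  by apply/seteqP; split => t /= tB; [move=> i _|move=> i]; exact: tB.
apply: fin_bigcap_measurable => // i _.
by rewrite -[X in measurable X]setTI; exact: measurable_tnth.
Qed.

Lemma tuple_measurableE n : @measurable _ (n.-tuple R) =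
  <<s [set box B | B in [set B : 'I_n -> set R | forall i, measurable (B i)]]
      >>.
Proof.
set G := [set box B | B in _].
apply/seteqP; split; last first.
  apply: smallest_sub; first exact: sigma_algebra_measurable.
  by move=> _ [B mB <-]; exact: measurable_box.
have mid : measurable_fun setT (id : g_sigma_algebraType G -> n.-tuple R).
  apply/measurable_fun_tnthP => i _ A mA; rewrite setTI.
  apply: sub_sigma_algebra.
  exists (fun j => if j == i then A else setT).
    by move=> j; case: ifP.
  apply/seteqP; split => t /=.
    by move=> /(_ i); rewrite eqxx.
  by move=> tA j; case: eqP => [->|].
by move=> A mA; have := mid measurableT A mA; rewrite setTI.
Qed.

Lemma independent_tuple n (H : set T) (X : {mfun T >-> n.-tuple R}) :
  measurable H ->
  (forall B : 'I_n -> set R, (forall i, measurable (B i)) ->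
     P (H `&` X @^-1` box B) = P H * P (X @^-1` box B)) ->
  forall E, measurable E -> P (H `&` X @^-1` E) = P H * P (X @^-1` E).
Proof.
move=> mH indep E mE.
have fPH : P H = (fine (P H))%:E by rewrite fineK// fin_num_measure.
have PH0 : (0 <= fine (P H))%R by rewrite fine_ge0.
pose m1 := pushforward (mrestr P mH) X.
pose m2 := mscale (NngNum PH0) (distribution P X).
suff : m1 E = m2 E.
  by rewrite /m1/= /pushforward/= /mrestr/= setIC => ->; rewrite /m2/=
      /mscale/= -fPH.
apply: (measure_unique
  [set box B | B in [set B : 'I_n -> set R | forall i, measurable (B i)]]
  (fun _ => setT)) => //.
- exact: tuple_measurableE.
- move=> _ _ [B mB <-] [C mC <-]; exists (fun i => B i `&` C i).
    by move=> i; exact: measurableI.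
  by apply/seteqP; split => t; [move=> tBC; split => i; have [] := tBC i
                              |move=> -[tB tC] i; split].
- by move=> _; exists (fun=> setT) => //; apply/seteqP; split.
- by rewrite bigcup_const.
- move=> _ [B mB <-].
  by rewrite /m1/= /m2/= /mscale/= /pushforward/= /mrestr/= -fPH setIC indep.
- by move=> _; rewrite /m1/= /pushforward/= /mrestr/=
    preimage_setT setTI ltey_eq fin_num_measure.
Qed.

Lemma law_tuple n (X : {mfun T >-> n.-tuple R}) (g : 'I_n -> R -> R) :
  (forall i, measurable_fun setT (g i)) -> (forall i x, (0 <= g i x)%R) ->
  (forall i, \int[leb]_x (g i x)%:E = 1) ->
  (forall B : 'I_n -> set R, (forall i, measurable (B i)) ->
     P (X @^-1` box B) = \prod_(i < n) \int[leb]_(x in B i) (g i x)%:E) ->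
  forall E, measurable E ->
  P (X @^-1` E) = iint (fun t => \prod_(i < n) (g i (tnth t i))%:E *
      (\1_E t)%:E).
Proof.
elim: n X g => [|n IH] X g mg g0 g1 XB E mE.
  rewrite /= big_ord0 mul1e indicE.
  have XE w : X w = [tuple] by apply: eq_from_tnth => -[].
  have [tE|tE] := boolP ([tuple] \in E).
    rewrite (_ : _ @^-1` _ = setT) ?probability_setT//.
    by apply/seteqP; split => // w _; rewrite /= XE; exact: set_mem.
  rewrite (_ : _ @^-1` _ = set0) ?measure0//.
  apply/seteqP; split => // w /=; rewrite XE => tE'.
  by move/negP: tE; apply; exact: mem_set.
have mX0 : measurable_fun setT ((fun w => thead (X w)) : T ->
    measurableTypeR R).
  exact: (measurableT_comp (f := fun t : n.+1.-tuple R => tnth t ord0)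
      (measurable_tnth ord0) (measurable_funPT X)).
have mX' : measurable_fun setT (fun w => [tuple of behead (X w)]).
  exact: (measurableT_comp (@measurable_behead _ _ n) (measurable_funPT X)).
pose X0 : {mfun T >-> measurableTypeR R} :=
  HB.pack ((fun w => thead (X w)) : T -> measurableTypeR R)
    (isMeasurableFun.Build _ _ _ _ _ mX0).
pose X' : {mfun T >-> n.-tuple R} :=
  HB.pack (fun w => [tuple of behead (X w)] : n.-tuple R)
    (isMeasurableFun.Build _ _ _ _ _ mX').
have mX0' : measurable_fun setT (fun w => (X0 w, X' w)).
  exact: measurable_fun_pair.
pose XX : {mfun T >-> (measurableTypeR R * n.-tuple R)%type} :=
  HB.pack (fun w => (X0 w, X' w)) (isMeasurableFun.Build _ _ _ _ _ mX0').
pose Bcons (A : set R) (B : 'I_n -> set R) (i : 'I_n.+1) :=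
  if unlift ord0 i is Some j then B j else A.
have mBcons A B : measurable A -> (forall i, measurable (B i)) ->
    forall i, measurable (Bcons A B i).
  by move=> mA mB i; rewrite /Bcons; case: unliftP.
have PAB A B : measurable A -> (forall i, measurable (B i)) ->
    P (X0 @^-1` A `&` X' @^-1` box B) =
    (\int[leb]_(x in A) (g ord0 x)%:E) *
    \prod_(i < n) \int[leb]_(x in B i) (g (lift ord0 i) x)%:E.
  move=> mA mB.
  rewrite (_ : _ `&` _ = X @^-1` box (Bcons A B)); last first.
    apply/seteqP; split => w /=.
      move=> [AX BX] i; rewrite /Bcons; case: unliftP => [j|] -> //.
      by have := BX j; rewrite (tuple_eta (X w)) tnthS; congr (B j (tnth _ j));
          exact/val_inj.
    move=> BX; split; first by have := BX ord0; rewrite /Bcons unlift_none.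
    move=> j; have := BX (lift ord0 j); rewrite /Bcons liftK.
    by rewrite (tuple_eta (X w)) tnthS; congr (B j (tnth _ j)); exact/val_inj.
  rewrite XB; last exact: mBcons.
  rewrite big_ord_recl {1}/Bcons unlift_none; congr (_ * _).
  by apply: eq_bigr => i _; rewrite /Bcons liftK.
have PA A : measurable A -> P (X0 @^-1` A) = \int[leb]_(x in A) (g ord0 x)%:E.
  move=> mA; have := PAB A (fun=> setT) mA (fun=> measurableT).
  rewrite [X in _ = _ * X]big1 ?mule1 => [<-|i _]; last exact: g1.
  by congr (P _); apply/seteqP; split => w; [split|case].
have PB B : (forall i, measurable (B i)) -> P (X' @^-1` box B) =
    \prod_(i < n) \int[leb]_(x in B i) (g (lift ord0 i) x)%:E.
  move=> mB; have := PAB setT B measurableT mB.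
  by rewrite g1 mul1e => <-; rewrite preimage_setT setTI.
have PX' A B : measurable A -> measurable B ->
    P (X0 @^-1` A `&` X' @^-1` B) = P (X0 @^-1` A) * P (X' @^-1` B).
  move=> mA mB; apply: independent_tuple => //.
    by rewrite -[X in measurable X]setTI; exact: (mX0 measurableT A mA).
  by move=> C mC; rewrite PAB// PB// PA.
pose nu := distribution P X0; pose rho := distribution P X'.
pose E' : set (measurableTypeR R * n.-tuple R) :=
    [set p : measurableTypeR R * n.-tuple R | E [tuple of (p.1 : R) :: p.2]].
have mE' : measurable E'.
  rewrite -[X in measurable X]setTI.
  exact: (@measurable_cons_pair R n).
have XE w : X w = [tuple of X0 w :: X' w].
  by rewrite [LHS]tuple_eta; exact/val_inj.
have XXE : XX @^-1` E' = X @^-1` E.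
  by apply/funext => w; exact: (esym (congr1 E (XE w))).
have -> : P (X @^-1` E) = (nu \x rho) E'.
  by rewrite (product_measure_unique (m' := distribution P XX))// -XXE.
rewrite /product_measure1.
have rho_fin x : rho (xsection E' x) \is a fin_num.
  by rewrite fin_num_measure//; exact: measurable_xsection.
transitivity (\int[nu]_x (fine (rho (xsection E' x)))%:E).
  by apply: eq_integral => x _; rewrite fineK.
rewrite (@integral_density _ nu (g ord0))//; last 2 first.
- apply: measurableT_comp => //.
  exact: (@measurable_fun_xsection _ _ _ _ _ rho).
- by move=> x; rewrite fine_ge0.
apply: eq_integral => x _; rewrite fineK//.
rewrite /rho /distribution /pushforward (IH X' (fun i => g (lift ord0 i)))//;
    last first.
  exact: measurable_xsection.
have mF : measurable_fun setT (fun t : n.-tuple R =>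
    \prod_(i < n) (g (lift ord0 i) (tnth t i))%:E * (\1_(xsection E' x) t)%:E :
        \bar R).
  apply: emeasurable_funM.
    apply: (measurable_prod_tnth (h := fun i x => (g (lift ord0 i) x)%:E)) => i.
    exact/measurable_EFinP.
  by apply/measurable_EFinP; apply: measurable_indic; exact:
      measurable_xsection.
rewrite -iintZl//; last 2 first.
- by move=> t; rewrite mule_ge0 ?lee_fin//; apply: (@prode_ge0 R) => i _;
    rewrite lee_fin.
- by rewrite lee_fin.
apply: eq_iint => t; rewrite big_ord_recl tnth0 muleA; congr (_ * _ * _).
  by apply: eq_bigr => i _; rewrite tnthS.
rewrite !indicE mem_xsection; congr (_%:R%:E); apply/idP/idP; rewrite !inE//.
Qed.

End probability.

(** * Cubes over boxes *)

Section slab.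
Context {R : realType}.
Local Open Scope ereal_scope.
Local Notation leb := (@lebesgue_measure R).

Lemma indic_box n (B : 'I_n -> set R) (t : n.-tuple R) :
  (\1_(box B) t)%:E = \prod_(i < n) (\1_(B i) (tnth t i))%:E :> \bar R.
Proof.
rewrite indicE; have [/set_mem tB|tB] := boolP (t \in box B).
  by rewrite big1// => i _; rewrite indicE mem_set//; exact: tB.
have [i Bi] : exists i, tnth t i \notin B i.
  apply/existsP; apply: contraNT tB; rewrite negb_exists => /forallP Bt.
  by apply: mem_set => i; have := Bt i; rewrite negbK => /set_mem.
by rewrite (bigD1 i)//= indicE (negbTE Bi) mul0e.
Qed.

Lemma measurable_indicE d (T : measurableType d) (A : set T) :
  measurable A -> measurable_fun setT (fun x => (\1_A x)%:E : \bar R).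
Proof. by move=> mA; apply/measurable_EFinP; exact: measurable_indic. Qed.

Lemma iint0 n : iint (fun _ : n.-tuple R => 0) = 0 :> \bar R.
Proof.
by elim: n => //= n IH; under eq_integral do rewrite IH; rewrite integral0.
Qed.

Lemma iint_indic_box n (B : 'I_n -> set R) : (forall i, measurable (B i)) ->
  iint (fun t => (\1_(box B) t)%:E) = \prod_(i < n) leb (B i).
Proof.
move=> mB; under eq_iint do rewrite indic_box.
rewrite (iint_prod (h := fun i x => (\1_(B i) x)%:E)).
- by apply: eq_bigr => i _; rewrite integral_indic ?setIT//; exact: mB.
- by move=> i; exact: measurable_indicE.
- by move=> i x; rewrite lee_fin.
Qed.

Lemma lee_prod (I : Type) (s : seq I) (P : pred I) (f g : I -> \bar R) :
  (forall i, P i -> 0 <= f i <= g i) ->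
  \prod_(i <- s | P i) f i <= \prod_(i <- s | P i) g i.
Proof.
move=> fg; suff : 0 <= \prod_(i <- s | P i) f i <=
    \prod_(i <- s | P i) g i by case/andP.
elim/big_rec2: _ => [|i x y Pi /andP[y0 yx]]; first by rewrite lee01 lexx.
by have /andP[fi0 fgi] := fg i Pi; rewrite mule_ge0//= lee_pmul.
Qed.

Lemma prod_EFin (I : Type) (s : seq I) (P : pred I) (f : I -> R) :
  \prod_(i <- s | P i) (f i)%:E = (\prod_(i <- s | P i) f i)%:E.
Proof. by elim/big_rec2: _ => // i x y _ ->; rewrite EFinM. Qed.

Lemma iint_hypercube k (eps : R) (H : set (k.-tuple R)) : (0 <= eps)%R ->
  hypercube eps H -> iint (fun z => (\1_H z)%:E) <= (eps ^+ k)%:E.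
Proof.
move=> eps0 [a [bl [br ->]]].
set I := fun j => [set` Interval (BSide (bl j) (a j))
    (BSide (br j) (a j + eps)%R)].
rewrite (_ : [set z | _] = box I)//.
rewrite iint_indic_box; last by move=> i; exact: measurable_itv.
rewrite -[in leRHS](card_ord k) -prodr_const -prod_EFin; apply: lee_prod => j _.
rewrite measure_ge0/= lebesgue_measure_itv/=; case: ifP => _.
  by rewrite -EFinB lee_fin addrC addKr.
by rewrite lee_fin.
Qed.

Lemma measurable_graph_comp d1 d2 d3 (T1 : measurableType d1)
    (T2 : measurableType d2) (T3 : measurableType d3) (h : T1 -> T2)
    (D : T2 -> set T3) : measurable_fun setT h ->
  measurable [set yz : T2 * T3 | D yz.1 yz.2] ->
  measurable [set yz : T1 * T3 | D (h yz.1) yz.2].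
Proof.
move=> mh mD.
have mf : measurable_fun setT (fun yz : T1 * T3 => (h yz.1, yz.2)).
  by apply: measurable_fun_pair => //; exact: (measurableT_comp mh).
by rewrite -[X in measurable X]setTI; exact: (mf measurableT _ mD).
Qed.

Definition lcoords p k (y : (p + k).-tuple R) : p.-tuple R :=
  [tuple tnth y (lshift k i) | i < p].
Definition rcoords p k (y : (p + k).-tuple R) : k.-tuple R :=
  [tuple tnth y (rshift p i) | i < k].

Lemma tnth_cat_lshift p k (u : p.-tuple R) (z : k.-tuple R) i :
  tnth [tuple of u ++ z] (lshift k i) = tnth u i.
Proof. by have /colP/(_ (lshift k i)) := tuple_col_cat u z;
    rewrite col_mxEu !mxE. Qed.

Lemma tnth_cat_rshift p k (u : p.-tuple R) (z : k.-tuple R) i :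
  tnth [tuple of u ++ z] (rshift p i) = tnth z i.
Proof. by have /colP/(_ (rshift p i)) := tuple_col_cat u z;
    rewrite col_mxEd !mxE. Qed.

Lemma lcoords_cat p k (u : p.-tuple R) (z : k.-tuple R) :
  lcoords [tuple of u ++ z] = u.
Proof. by apply: eq_from_tnth => i; rewrite tnth_mktuple tnth_cat_lshift. Qed.

Lemma rcoords_cat p k (u : p.-tuple R) (z : k.-tuple R) :
  rcoords [tuple of u ++ z] = z.
Proof. by apply: eq_from_tnth => i; rewrite tnth_mktuple tnth_cat_rshift. Qed.

Lemma measurable_lcoords p k : measurable_fun setT (@lcoords p k).
Proof.
apply/measurable_fun_tnthP => i.
rewrite (_ : _ \o _ = fun y => tnth y (lshift k i)); first exact:
    measurable_tnth.
by apply/funext => y /=; rewrite tnth_mktuple.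
Qed.

Lemma measurable_rcoords p k : measurable_fun setT (@rcoords p k).
Proof.
apply/measurable_fun_tnthP => i.
rewrite (_ : _ \o _ = fun y => tnth y (rshift p i)); first exact:
    measurable_tnth.
by apply/funext => y /=; rewrite tnth_mktuple.
Qed.

Section cube.
Variables (p k : nat) (eps : R) (D : p.-tuple R -> set (k.-tuple R)).
Hypotheses (eps0 : (0 <= eps)%R) (cubeD : forall u, hypercube eps (D u))
  (mD : measurable [set yz : p.-tuple R * k.-tuple R | D yz.1 yz.2]).

Definition graph_preimage n (B : 'M[R]_(p, n)) (Z : 'M[R]_(k, n)) :
    set (n.-tuple R) :=
  [set x | D (linmap B x) (linmap Z x)].

Lemma measurable_graph_preimage n (B : 'M[R]_(p, n)) (Z : 'M[R]_(k, n)) :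
  measurable (graph_preimage B Z).
Proof.
have mBZ : measurable_fun setT (fun x => (linmap B x, linmap Z x)).
  by apply: measurable_fun_pair; exact: measurable_linmap.
by rewrite -[X in measurable X]setTI; exact: (mBZ measurableT _ mD).
Qed.

Definition slab n (J : 'I_p -> set R) (B : 'M[R]_(p, n)) (Z : 'M[R]_(k, n)) :
  set (n.-tuple R) := linmap B @^-1` box J `&` graph_preimage B Z.

Lemma measurable_slab n (J : 'I_p -> set R) (B : 'M[R]_(p, n))
    (Z : 'M[R]_(k, n)) :
  (forall i, measurable (J i)) -> measurable (slab J B Z).
Proof.
move=> mJ; apply: measurableI; last exact: measurable_graph_preimage.
by rewrite -[X in measurable X]setTI; apply: measurable_linmap => //; exact:
    measurable_box.
Qed.

Lemma iint_slab (J : 'I_p -> set R) (B : 'M[R]_(p, p + k))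
    (Z : 'M[R]_(k, p + k)) :
  col_mx B Z \in unitmx -> (forall i, measurable (J i)) ->
  `|\det (col_mx B Z)|%:E * iint (fun x => (\1_(slab J B Z) x)%:E) <=
  (\prod_(i < p) leb (J i)) * (eps ^+ k)%:E.
Proof.
move=> BZu mJ.
pose A : set ((p + k).-tuple R) :=
  [set y | box J (lcoords y) /\ D (lcoords y) (rcoords y)].
have mA : measurable A.
  apply: measurableI.
    rewrite -[X in measurable X]setTI; apply: measurable_lcoords => //.
    exact: measurable_box.
  have mlr : measurable_fun setT (fun y => (@lcoords p k y, @rcoords p k y)).
    by apply: measurable_fun_pair; [exact: measurable_lcoords|exact:
        measurable_rcoords].
  by rewrite -[X in measurable X]setTI; exact: (mlr measurableT _ mD).
have -> : iint (fun x => (\1_(slab J B Z) x)%:E) =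
    iint ((fun y => (\1_A y)%:E) \o linmap (col_mx B Z)).
  apply: eq_iint => x /=; rewrite !indicE; congr ((nat_of_bool _)%:R%:E).
  apply/idP/idP => /set_mem h; apply: mem_set; move: h;
    by rewrite /A/= linmap_col_mx lcoords_cat rcoords_cat.
rewrite -(iint_linmap BZu); [|exact: measurable_indicE|by move=> t;
    rewrite lee_fin].
rewrite iint_cat -iint_indic_box//.
rewrite muleC -iintZl; [|apply: measurable_indicE; exact:
    measurable_box|by move=> t; rewrite lee_fin|by rewrite lee_fin exprn_ge0].
have mAuz : measurable_fun setT (fun q : p.-tuple R * k.-tuple R =>
    (\1_A [tuple of q.1 ++ q.2])%:E : \bar R).
  apply: (measurableT_comp (measurable_indicE mA)).
  apply/measurable_fun_tnthP => i; case: (split_ordP i) => j ->.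
    rewrite (_ : _ \o _ = fun q : p.-tuple R * k.-tuple R => tnth q.1 j);
        last first.
      by apply/funext => q /=; rewrite tnth_cat_lshift.
    exact: (measurableT_comp (measurable_tnth j)).
  rewrite (_ : _ \o _ = fun q : p.-tuple R * k.-tuple R => tnth q.2 j);
      last first.
    by apply/funext => q /=; rewrite tnth_cat_rshift.
  exact: (measurableT_comp (measurable_tnth j)).
apply: le_iint.
- by apply: (measurable_iint (F := fun (u : p.-tuple R) (z : k.-tuple R) =>
    (\1_A [tuple of u ++ z])%:E)) => // u z; rewrite lee_fin.
- by apply: emeasurable_funM => //; apply: measurable_indicE; exact:
    measurable_box.
- by move=> u; apply: iint_ge0 => z; rewrite lee_fin.
- move=> u; have [uJ|uJ] := boolP (u \in box J).
    rewrite [in X in _ <= X]indicE uJ mule1.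
    apply: le_trans (iint_hypercube eps0 (cubeD u)).
    rewrite le_eqVlt; apply/orP; left; apply/eqP; apply: eq_iint => z.
    rewrite !indicE; congr ((nat_of_bool _)%:R%:E).
    apply/idP/idP => /set_mem h; apply: mem_set; move: h;
      rewrite /A/= lcoords_cat rcoords_cat; first by case.
    by split => //; exact: set_mem.
  rewrite [in X in _ <= X]indicE (negbTE uJ) mule0.
  rewrite (_ : iint _ = 0)// -[RHS](iint0 k).
  apply: eq_iint => z; rewrite indicE memNset// /A/= lcoords_cat => -[uJ' _].
  by move/negP : uJ; apply; exact: mem_set.
Qed.

End cube.
End slab.

Section box_bound.
Context {R : realType}.
Local Notation leb := (@lebesgue_measure R).

Section vertices.
Variables (p n : nat) (B : 'M[R]_(p, n)) (a b : 'I_n -> R) (i0 : 'I_n).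
Implicit Types S t : {set 'I_n}.

Definition Bcols S : 'M[R]_p := colsub (@cols n p i0 S) B.

Definition endpoints S t : 'cV[R]_n :=
  \col_j (if j \in S then 0 else if j \in t then b j else a j).

Definition shift S t i : R := (invmx (Bcols S) *m B *m endpoints S t) i 0.

Definition vertex_itv S t (i : 'I_p) : set R :=
  `[a (cols i0 S i) + shift S t i, b (cols i0 S i) + shift S t i]%classic.

Lemma box_vertex (x : 'cV[R]_n) : row_free B -> in_box a b x ->
  exists S t, [/\ #|S| = p, Bcols S \in unitmx, t \subset ~: S &
    forall i, vertex_itv S t i ((invmx (Bcols S) *m B *m x) i 0)].
Proof.
move=> Bf xab; have [S [y [cS sS yab By yS]]] := exists_vertex Bf xab.
have Cu : Bcols S \in unitmx by exact: colsub_unit.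
exists S, [set j in ~: S | y j 0 == b j]%SET; split => //.
  by apply/fintype.subsetP => j; rewrite !inE => /andP[].
set t := [set j in _ | _]%SET => i.
have yE : y = endpoints S t + \col_j (if j \in S then y j 0 else 0).
  apply/colP => j; rewrite !mxE; case: ifPn => jS; first by rewrite add0r.
  rewrite addr0 !inE jS/=; case: eqP => [//|yb].
  by have [] := yS j jS.
have yC : B *m (\col_j (if j \in S then y j 0 else 0)) =
    Bcols S *m (\col_i y (cols i0 S i) 0).
  apply/colP => l; rewrite !mxE (bigID (mem S))/= [X in _ + X]big1 ?addr0;
      last first.
    by move=> j /negbTE jS; rewrite mxE jS mulr0.
  rewrite -(big_cols _ i0 _ cS); apply: eq_bigr => j _.
  by rewrite !mxE cols_in.
have -> : invmx (Bcols S) *m B *m x =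
    invmx (Bcols S) *m B *m endpoints S t + \col_i y (cols i0 S i) 0.
  by rewrite -mulmxA -By {1}yE mulmxDr yC mulmxDr mulKmx// mulmxA.
rewrite [X in vertex_itv _ _ _ X]mxE [X in _ + X]mxE -/(shift S t i)
    /vertex_itv /= in_itv/=.
by have /andP[? ?] := yab (cols i0 S i); rewrite addrC !lerD2r; apply/andP.
Qed.

End vertices.

Local Open Scope ereal_scope.

Lemma iint_sum_cond n (I : Type) (s : seq I) (Q : pred I)
    (F : I -> n.-tuple R -> \bar R) :
  (forall i, measurable_fun setT (F i)) -> (forall i t, 0 <= F i t) ->
  iint (fun t => \sum_(i <- s | Q i) F i t) = \sum_(i <- s | Q i) iint (F i).
Proof.
by move=> mF F0; under eq_iint do rewrite -big_filter;
    rewrite iint_sum// big_filter.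
Qed.

Variables (p k : nat) (eps : R) (D : p.-tuple R -> set (k.-tuple R)).
Hypotheses (eps0 : (0 <= eps)%R) (cubeD : forall u, hypercube eps (D u))
  (mD : measurable [set yz : p.-tuple R * k.-tuple R | D yz.1 yz.2]).
Variables (B : 'M[R]_(p, p + k)) (Z : 'M[R]_(k, p + k)).
Hypotheses (B1 : forall i j, (`|B i j| <= 1)%R) (BZu : col_mx B Z \in unitmx)
  (detBZ : (1 <= `|\det (col_mx B Z)|)%R).

Lemma iint_vertex_slab (a b : 'I_(p + k) -> R) i0 (S t : {set 'I_(p + k)}) :
  (forall j, (a j <= b j)%R) -> #|S| = p -> Bcols B i0 S \in unitmx ->
  iint (fun x => (\1_(slab (D \o linmap (Bcols B i0 S))
      (vertex_itv B a b i0 S t)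
       (invmx (Bcols B i0 S) *m B) Z) x)%:E) <=
  (p`!%:R * eps ^+ k * \prod_(j in S) (b j - a j))%:E.
Proof.
move=> ab cS Cu; set C := Bcols B i0 S in Cu *.
have CE : col_mx (invmx C *m B) Z = block_mx (invmx C) 0%R 0%R 1%:M *m col_mx B
    Z.
  by rewrite mul_block_col !mul0mx addr0 add0r mul1mx.
have detC : (\det C * \det (col_mx (invmx C *m B) Z) = \det (col_mx B Z))%R.
  rewrite CE det_mulmx det_ublock det1 mulr1 det_inv mulVKf//.
  by move: Cu; rewrite unitmxE unitfE.
have detC0 : (`|\det C| <= p`!%:R)%R.
  by apply: det_le_fact => i j; rewrite mxE.
have C'u : col_mx (invmx C *m B) Z \in unitmx.
  rewrite CE unitmx_mul BZu andbT unitmxE det_ublock det1 mulr1 -unitmxE.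
  by rewrite unitmx_inv.
set V := vertex_itv _ _ _ _ _ _; set L := iint _.
have L0 : 0 <= L by apply: iint_ge0 => x; rewrite lee_fin.
have mD' : measurable [set yz : p.-tuple R * k.-tuple R | (D \o linmap C) yz.1
    yz.2].
  exact: measurable_graph_comp (measurable_linmap C) mD.
have := iint_slab eps0 (fun u => cubeD (linmap C u)) mD' C'u (J := V)
    (fun=> measurable_itv _).
rewrite -/L => LL.
apply: (@le_trans _ _ (`|\det (col_mx B Z)|%:E * L)).
  by rewrite -[leLHS]mul1e; apply: lee_wpmul2r => //; rewrite lee_fin.
rewrite -detC normrM EFinM -muleA.
apply: (@le_trans _ _ (`|\det C|%:E * (\prod_(i < p) leb (V i) *
    (eps ^+ k)%:E))).
  by apply: lee_wpmul2l => //; rewrite lee_fin.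
have -> : \prod_(i < p) leb (V i) = (\prod_(j in S) (b j - a j))%:E.
  rewrite -(big_cols _ i0 _ cS) -prod_EFin; apply: eq_bigr => i _.
  rewrite /V /vertex_itv lebesgue_measure_itv/= lte_fin ltrD2r.
  case: ltP => [_|ba]; first by rewrite -EFinB; congr EFin; ring.
  have -> : b (cols i0 S i) = a (cols i0 S i) by apply/eqP; rewrite eq_le ba ab.
  by rewrite subrr.
rewrite -!EFinM lee_fin [leRHS]mulrAC -[leRHS]mulrA; apply: ler_wpM2r => //.
by rewrite mulr_ge0 ?exprn_ge0// prodr_ge0// => j _; rewrite subr_ge0.
Qed.

Lemma iint_box_graph (a b : 'I_(p + k) -> R) : (0 < p + k)%N ->
  (forall j, (a j <= b j)%R) ->
  iint (fun x => (\1_(box (fun j => `[a j, b j]%classic) `&`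
      graph_preimage D B Z) x)%:E) <=
  (\sum_(S : {set 'I_(p + k)} | #|S| == p)
     2 ^+ k * p`!%:R * eps ^+ k * \prod_(j in S) (b j - a j))%:E.
Proof.
move=> pk0 ab; pose i0 : 'I_(p + k) := Ordinal pk0.
pose Q (q : {set 'I_(p + k)} * {set 'I_(p + k)}) :=
  (#|q.1| == p) && (Bcols B i0 q.1 \in unitmx) && (q.2 \subset ~: q.1).
pose SL (q : {set 'I_(p + k)} * {set 'I_(p + k)}) :=
  slab (D \o linmap (Bcols B i0 q.1)) (vertex_itv B a b i0 q.1 q.2)
       (invmx (Bcols B i0 q.1) *m B) Z.
have mSL q : measurable (SL q).
  apply: measurable_slab => [|i]; last exact: measurable_itv.
  exact: measurable_graph_comp (measurable_linmap _) mD.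
have Bf : row_free B.
  have : row_free (col_mx B Z) by rewrite row_free_unit.
  rewrite -!kermx_eq0; apply: contraTT => /rowV0Pn[u /sub_kermxP uB u0].
  apply/rowV0Pn; exists (row_mx u 0); last by rewrite row_mx_eq0 negb_and u0.
  by apply/sub_kermxP; rewrite mul_row_col uB mul0mx addr0.
apply: (@le_trans _ _ (iint (fun x => \sum_(q | Q q) (\1_(SL q) x)%:E))).
  apply: le_iint.
  - apply: measurable_indicE; apply: measurableI; last exact:
      measurable_graph_preimage.
    by apply: measurable_box => j; exact: measurable_itv.
  - under eq_fun do rewrite -big_filter.
    by apply: emeasurable_sum => q; exact: measurable_indicE.
  - by move=> x; rewrite lee_fin.
  - move=> x; rewrite [in X in X <= _]indicE.
    have [/set_mem[xab xD]|_] := boolP (x \in _); last by apply: sume_ge0 =>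
        q _; rewrite lee_fin.
    have xab' : in_box a b (tuple_col x).
      by move=> j; have := xab j; rewrite /= in_itv/= mxE.
    have [S [t [cS Cu tS xV]]] := box_vertex i0 Bf xab'.
    rewrite (bigD1 (S, t))/=; last by rewrite /Q/= cS eqxx Cu tS.
    rewrite -[leLHS]adde0; apply: leeD; last by apply: sume_ge0 => q _;
        rewrite lee_fin.
    rewrite indicE mem_set// /SL/=; split.
      by move=> i; have := xV i; rewrite /= -tuple_col_linmap mxE.
    move: xD; rewrite /graph_preimage /= -linmapM mulmxA mulmxV// mul1mx.
    by [].
rewrite iint_sum_cond; [|by move=> q; exact: measurable_indicE|by move=> q x;
    rewrite lee_fin].
apply: (@le_trans _ _ (\sum_(q | Q q) (p`!%:R * eps ^+ k * \prod_(j in q.1)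
    (b j - a j))%:E)).
  apply: lee_sum => -[S t] /andP[/andP[/eqP cS Cu] _]; exact: iint_vertex_slab.
rewrite sumEFin lee_fin.
have pos (S : {set 'I_(p + k)}) : (0 <=
    p`!%:R * eps ^+ k * \prod_(j in S) (b j - a j))%R.
  by rewrite !mulr_ge0 ?exprn_ge0// prodr_ge0// => j _; rewrite subr_ge0.
apply: (@le_trans _ _ (\sum_(q : {set 'I_(p + k)} * {set 'I_(p + k)} |
    (#|q.1| == p) && (q.2 \subset ~: q.1))
    p`!%:R * eps ^+ k * \prod_(j in q.1) (b j - a j))%R).
  rewrite [leLHS]big_mkcond [leRHS]big_mkcond/=; apply: ler_sum => q _.
  rewrite /Q; case: (_ == p) => //=; case: (_ \in unitmx) => //=.
  by case: ifP.
rewrite -(pair_big_dep (fun S : {set 'I_(p + k)} => #|S| == p)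
    (fun S t : {set 'I_(p + k)} => t \subset ~: S)
  (fun S _ => p`!%:R * eps ^+ k * \prod_(j in S) (b j - a j))%R)/=.
rewrite le_eqVlt; apply/orP; left; apply/eqP; apply: eq_bigr => S /eqP cS.
rewrite (eq_bigl (mem (powerset (~: S)))); last by move=> t; rewrite /=
    powersetE.
rewrite sumr_const card_powerset cardsCs finset.setCK card_ord cS addKn.
by rewrite -[LHS]mulr_natl natrX !mulrA.
Qed.

End box_bound.

(** * Integrals of product densities *)

Section density_bounds.
Context {R : realType}.
Local Open Scope ereal_scope.
Local Notation leb := (@lebesgue_measure R).

Lemma lebesgue_measure_interval (X : set R) : is_interval X -> X !=set0 ->
  has_lbound X -> has_ubound X -> leb X = (sup X - inf X)%:E.
Proof.
move=> /is_intervalP iX [x Xx] lX uX.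
rewrite {1}iX /Rhull (asboolT lX) (asboolT uX) lebesgue_measure_itv/= lte_fin.
case: ltP => // sX; apply/esym; congr EFin; apply/eqP;
    rewrite subr_eq0 eq_le sX/=.
by apply: (@le_trans _ _ x); [exact: ge_inf|exact: ub_le_sup].
Qed.

Variables (p k : nat) (eps phi : R) (D : p.-tuple R -> set (k.-tuple R)).
Hypotheses (k0 : (0 < k)%N) (eps0 : (0 <= eps)%R) (phi0 : (0 <= phi)%R)
  (cubeD : forall u, hypercube eps (D u))
  (mD : measurable [set yz : p.-tuple R * k.-tuple R | D yz.1 yz.2]).
Variables (B : 'M[R]_(p, p + k)) (Z : 'M[R]_(k, p + k)).
Hypotheses (B1 : forall i j, (`|B i j| <= 1)%R) (BZu : col_mx B Z \in unitmx)
  (detBZ : (1 <= `|\det (col_mx B Z)|)%R).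
Variable g : 'I_(p + k) -> R -> R.
Hypotheses (mg : forall i, measurable_fun setT (g i))
  (g_phi : forall i x, (0 <= g i x <= phi)%R)
  (g_out : forall i x, (1 < `|x|)%R -> g i x = 0%R)
  (g_int : forall i, \int[leb]_x (g i x)%:E = 1).

Let E := graph_preimage D B Z.
Let mE : measurable E := measurable_graph_preimage mD B Z.
Let g0 i x : (0 <= g i x)%R. Proof. by have /andP[] := g_phi i x. Qed.

Lemma linmap_bound (x : (p + k).-tuple R) i :
  (forall j, `|tnth x j| <= 1)%R -> (`|tnth (linmap B x) i| <= (p + k)%:R)%R.
Proof.
move=> x1; rewrite tnth_linmap; apply: le_trans (ler_norm_sum _ _ _) _.
rewrite -[(p + k)%:R%R]mulr_natl mulr1.
have <- : (\sum_(j < p + k) 1 = (p + k)%:R :> R)%R by rewrite sumr_const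
    card_ord.
by apply: ler_sum => j _; rewrite normrM mulr_ile1.
Qed.

Lemma iint_density_bounded :
  iint (fun x => \prod_(i < p + k) (g i (tnth x i))%:E * (\1_E x)%:E) <=
  ((2 * (p + k)%:R) ^+ p * phi ^+ (p + k) * eps ^+ k)%:E.
Proof.
pose J (i : 'I_p) : set R := `[- (p + k)%:R, (p + k)%:R]%classic%R.
have mJ i : measurable (J i) by exact: measurable_itv.
have mS : measurable (slab D J B Z) by exact: measurable_slab.
apply: (@le_trans _ _ (iint (fun x => (phi ^+ (p + k))%:E *
    (\1_(slab D J B Z) x)%:E))).
  apply: le_iint.
  - apply: emeasurable_funM; last exact: measurable_indicE.
    apply: (measurable_prod_tnth (h := fun i x => (g i x)%:E)) => i.
    exact/measurable_EFinP.
  - by apply: emeasurable_funM => //; exact: measurable_indicE.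
  - move=> x; rewrite mule_ge0 ?lee_fin//.
    by apply: (@prode_ge0 R) => i _; rewrite lee_fin.
  - move=> x; have [x1|] := boolP [forall j, `|tnth x j| <= 1]%R; last first.
      rewrite negb_forall => /existsP[j]; rewrite -ltNge => xj.
      rewrite (bigD1 j)//= g_out// !mul0e mule_ge0 ?lee_fin ?exprn_ge0//.
    apply: lee_pmul; rewrite ?lee_fin//.
    + by apply: (@prode_ge0 R) => i _; rewrite lee_fin.
    + rewrite prod_EFin lee_fin -[in leRHS](card_ord (p + k)) -prodr_const.
      by apply: ler_prod => i _; exact: g_phi.
    rewrite !indicE ler_nat; case: (boolP (x \in E)) => // /set_mem xE.
    rewrite mem_set//; split => // i; rewrite /J/= in_itv/= -ler_norml.
    by apply: linmap_bound; exact/forallP.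
rewrite iintZl; [|exact: measurable_indicE|by move=> x;
    rewrite lee_fin|by rewrite lee_fin exprn_ge0].
have := iint_slab eps0 cubeD mD BZu mJ; set L := iint _ => LL.
have L0 : 0 <= L by apply: iint_ge0 => x; rewrite lee_fin.
apply: (@le_trans _ _ ((phi ^+ (p + k))%:E * (`|\det (col_mx B Z)|%:E * L))).
  apply: lee_wpmul2l; first by rewrite lee_fin exprn_ge0.
  by rewrite -[leLHS]mul1e; apply: lee_wpmul2r => //; rewrite lee_fin.
have vol : \prod_(i < p) leb (J i) = ((2 * (p + k)%:R) ^+ p)%:E.
  rewrite (eq_bigr (fun=> (2 * (p + k)%:R)%:E)); last first.
    move=> i _; rewrite /J lebesgue_measure_itv/= lte_fin -EFinB.
    have N0 : (0 < (p + k)%:R :> R)%R by rewrite ltr0n addn_gt0 k0 orbT.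
    by rewrite ifT; [congr EFin; ring|lra].
  by rewrite prod_EFin prodr_const card_ord.
rewrite vol in LL; apply: le_trans (lee_wpmul2l _ LL) _;
    first by rewrite lee_fin exprn_ge0.
by rewrite -!EFinM lee_fin mulrCA mulrA.
Qed.

Let N := (p + k)%N.
Let bound : R := (2 ^+ k * p`!%:R * eps ^+ k)%R.
Let level i t : set R := [set x | subgraph (g i) (x, t)].

Definition level_size i (t : R) : \bar R :=
    \int[leb]_x (\1_(subgraph (g i)) (x, t))%:E.

Lemma level_sizeE i t : level_size i t = leb (level i t).
Proof.
have mL : measurable (level i t).
  have := measurable_ysection t (measurable_subgraph (mg i)); congr measurable.
  by apply/seteqP; split => x; rewrite /ysection /level /= inE.
transitivity (\int[leb]_x (\1_(level i t) x)%:E);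
    last by rewrite integral_indic ?setIT.
apply: eq_integral => x _; rewrite !indicE.
by congr ((nat_of_bool _)%:R%:E); apply/idP/idP => /set_mem h; apply: mem_set.
Qed.

Lemma measurable_level_size i : measurable_fun setT (level_size i).
Proof.
have mS := @measurable_indic_subgraph R _ (measurableTypeR R) (g i) (mg i).
apply: (@measurable_fun_fubini_tonelli_G _ _ _ _ R leb
  (fun p : measurableTypeR R * measurableTypeR R =>
      (\1_(subgraph (g i)) p)%:E)) => //.
Qed.

Lemma level_size_ge0 i t : 0 <= level_size i t.
Proof. by apply: integral_ge0 => x _; rewrite lee_fin. Qed.

Lemma integral_level_size i : \int[leb]_t level_size i t = 1.
Proof.
have mS := @measurable_indic_subgraph R _ (measurableTypeR R) (g i) (mg i).
rewrite -(g_int i); have := @fubini_tonelli _ _ _ _ _ leb leb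
  (fun p : measurableTypeR R * measurableTypeR R => (\1_(subgraph (g i)) p)%:E)
      mS.
rewrite /fubini_F /fubini_G /= => <- //.
by apply: eq_integral => x _; rewrite subgraph_layer.
Qed.

Hypothesis g_quasi : forall i t, (0 < t)%R ->
    is_interval [set x | (t <= g i x)%R].

Definition level_weight (S : {set 'I_N}) i (t : R) : \bar R :=
  if i \in S then level_size i t else (\1_(`]0%R, phi]%classic) t)%:E.

Lemma iint_levels (t : N.-tuple R) :
  iint (fun x => \prod_(i < N) (\1_(subgraph (g i)) (tnth x i, tnth t i))%:E *
      (\1_E x)%:E) <=
  \sum_(S : {set 'I_N} | #|S| == p) bound%:E * \prod_(i < N) level_weight S i
      (tnth t i).
Proof.
have [/existsP[i /asboolP Li0]|Lne] :=
    boolP [exists i, `[< level i (tnth t i) = set0 >]].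
  rewrite (_ : iint _ = 0) ?sume_ge0// => [S _|].
    rewrite mule_ge0 ?lee_fin ?mulr_ge0 ?exprn_ge0//.
    apply: (@prode_ge0 R) => j _; rewrite /level_weight; case: ifP => _;
        last by rewrite lee_fin.
    exact: level_size_ge0.
  rewrite -[RHS](iint0 N); apply: eq_iint => x; rewrite (bigD1 i)//=
      indicE memNset ?mul0e//.
  by move=> xi; have : level i (tnth t i) (tnth x i) := xi; rewrite Li0.
have {}Lne i : level i (tnth t i) !=set0.
  by apply/set0P; move: Lne; rewrite negb_exists =>
      /forallP/(_ i) /asboolPn/eqP.
have t0 i : (0 < tnth t i <= phi)%R.
  have [x /= /andP[-> tg]] := Lne i; apply: le_trans tg _.
  by have /andP[] := g_phi i x.
have levelE i : level i (tnth t i) = [set x | (tnth t i <= g i x)%R].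
  by apply/seteqP; split => x; rewrite /level/subgraph/=; have /andP[-> _] :=
      t0 i.
have level1 i x : level i (tnth t i) x -> (-1 <= x <= 1)%R.
  rewrite -ler_norml leNgt /level/subgraph/= => /andP[ti tg]; apply:
      contraTN tg => x1.
  by rewrite g_out// -ltNge.
pose a i := inf (level i (tnth t i)); pose b i := sup (level i (tnth t i)).
have hl i : has_lbound (level i (tnth t i)) by exists (-1)%R =>
    x /level1/andP[].
have hu i : has_ubound (level i (tnth t i)) by exists 1%R => x /level1/andP[].
have ab i : (a i <= b i)%R.
  by have [x Lx] := Lne i; apply: (@le_trans _ _ x);
      [exact: ge_inf|exact: ub_le_sup].
have sizeE i : level_size i (tnth t i) = (b i - a i)%:E.
  rewrite level_sizeE lebesgue_measure_interval// levelE; apply: g_quasi.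
  by have /andP[] := t0 i.
have := iint_box_graph eps0 cubeD mD B1 BZu detBZ (a := a) (b := b) _ ab.
rewrite addn_gt0 k0 orbT => /(_ isT) LB.
apply: le_trans (le_trans LB _).
  apply: le_iint.
  - apply: emeasurable_funM; last exact: measurable_indicE.
    apply: (measurable_prod_tnth (h := fun i x =>
        (\1_(subgraph (g i)) (x, tnth t i))%:E)) => i.
    apply: (measurableT_comp (measurable_indicE (measurable_subgraph (mg i)))).
    exact: measurable_fun_pair.
  - apply: measurable_indicE; apply: measurableI => //.
    by apply: measurable_box => i; exact: measurable_itv.
  - move=> x; rewrite mule_ge0 ?lee_fin//.
    by apply: (@prode_ge0 R) => i _; rewrite lee_fin.
  - move=> x; rewrite -/E.
    have -> : \prod_(i < N) (\1_(subgraph (g i)) (tnth x i, tnth t i))%:E =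
        (\1_(box (fun i => level i (tnth t i))) x)%:E :> \bar R.
      rewrite indic_box; apply: eq_bigr => i _; rewrite !indicE.
      by congr ((nat_of_bool _)%:R%:E); apply/idP/idP => /set_mem h; apply:
          mem_set.
    rewrite -EFinM lee_fin !indicE -natrM mulnb ler_nat.
    case: (boolP (_ && _)) => // /andP[/set_mem xL xE].
    rewrite mem_set//; split; last exact: set_mem.
    move=> i; have xi := xL i; rewrite /= in_itv/=.
    by apply/andP; split; [exact: ge_inf|exact: ub_le_sup].
rewrite -sumEFin; apply: lee_sum => S _; rewrite EFinM; apply: lee_wpmul2l.
  by rewrite lee_fin !mulr_ge0 ?exprn_ge0.
rewrite -prod_EFin big_mkcond/=; apply: lee_prod => i _.
rewrite /level_weight; case: ifP => _.
  by rewrite sizeE lexx andbT lee_fin subr_ge0.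
by rewrite lee01 indicE mem_set//= in_itv/=; exact: t0.
Qed.

Lemma measurable_level_weight S i : measurable_fun setT (level_weight S i).
Proof.
rewrite /level_weight; have [_|_] := boolP (i \in S).
  exact: measurable_level_size.
by apply: measurable_indicE; exact: measurable_itv.
Qed.

Lemma level_weight_ge0 S i t : 0 <= level_weight S i t.
Proof.
by rewrite /level_weight; case: ifP => _;
    [exact: level_size_ge0|rewrite lee_fin].
Qed.

Lemma iint_density_quasiconcave :
  iint (fun x => \prod_(i < N) (g i (tnth x i))%:E * (\1_E x)%:E) <=
  (2 ^+ k * N%:R ^+ p * phi ^+ k * eps ^+ k)%:E.
Proof.
have layerE (x : N.-tuple R) : \prod_(i < N) (g i (tnth x i))%:E * (\1_E x)%:E =
    iint (fun t : N.-tuple R => \prod_(i < N)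
        (\1_(subgraph (g i)) (tnth x i, tnth t i))%:E * (\1_E x)%:E).
  have mh i : measurable_fun setT (fun t : R =>
      (\1_(subgraph (g i)) (tnth x i, t))%:E : \bar R).
    apply: (measurableT_comp (measurable_indicE (measurable_subgraph (mg i)))).
    exact: measurable_fun_pair.
  under [RHS]eq_iint do rewrite muleC.
  rewrite iintZl; [|exact: (measurable_prod_tnth
      (h := fun i t => (\1_(subgraph (g i)) (tnth x i, t))%:E))| |by rewrite
          lee_fin]; last first.
    by move=> t; apply: (@prode_ge0 R) => i _; rewrite lee_fin.
  rewrite (iint_prod (h := fun i t => (\1_(subgraph (g i))
      (tnth x i, t))%:E))//.
  rewrite muleC; congr (_ * _); apply: eq_bigr => i _.
  by rewrite (@subgraph_layer R _ R (g i)).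
under eq_iint do rewrite layerE.
pose F (x t : N.-tuple R) : \bar R :=
  \prod_(i < N) (\1_(subgraph (g i)) (tnth x i, tnth t i))%:E * (\1_E x)%:E.
have mF : measurable_fun setT (fun q : N.-tuple R * N.-tuple R => F q.1 q.2).
  apply: emeasurable_funM.
    apply: emeasurable_prod => i.
    apply: (measurableT_comp (measurable_indicE (measurable_subgraph (mg i)))
      (g := fun q : N.-tuple R * N.-tuple R => (tnth q.1 i, tnth q.2 i))).
    by apply: measurable_fun_pair; exact:
        (measurableT_comp (measurable_tnth i)).
  exact: (measurableT_comp (measurable_indicE mE)).
have F0 x t : 0 <= F x t.
  rewrite mule_ge0 ?lee_fin//.
  by apply: (@prode_ge0 R) => i _; rewrite lee_fin.
rewrite (iint_swap mF F0).
have mW S : measurable_fun setT (fun t : N.-tuple R =>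
    \prod_(i < N) level_weight S i (tnth t i)).
  by apply: measurable_prod_tnth => i; exact: measurable_level_weight.
have W0 S (t : N.-tuple R) : 0 <= \prod_(i < N) level_weight S i (tnth t i).
  by apply: (@prode_ge0 R) => i _; exact: level_weight_ge0.
have bound0 : (0 <= bound)%R by rewrite !mulr_ge0 ?exprn_ge0.
apply: (@le_trans _ _ (iint (fun t : N.-tuple R =>
    \sum_(S : {set 'I_N} | #|S| == p) bound%:E * \prod_(i < N) level_weight S i
        (tnth t i)))).
  apply: le_iint.
  - apply: (measurable_iint (F := fun t x => F x t)) => //.
    apply: (measurableT_comp mF (g := fun q => (q.2, q.1))).
    exact: measurable_fun_pair.
  - under eq_fun do rewrite -big_filter.
    by apply: emeasurable_sum => S; exact: emeasurable_funM.
  - by move=> t; exact: iint_ge0.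
  - exact: iint_levels.
rewrite iint_sum_cond; last 2 first.
- by move=> S; exact: emeasurable_funM.
- by move=> S t; rewrite mule_ge0 ?lee_fin.
have LS (S : {set 'I_N}) : #|S| == p ->
    iint (fun t : N.-tuple R => bound%:E * \prod_(i < N) level_weight S i
        (tnth t i)) =
    (2 ^+ k * p`!%:R * eps ^+ k * phi ^+ k)%:E.
  move=> /eqP cS; rewrite iintZl ?lee_fin//.
  rewrite (iint_prod (h := level_weight S)); last 2 first.
  - exact: measurable_level_weight.
  - exact: level_weight_ge0.
  rewrite [RHS]EFinM; congr (_ * _).
  rewrite (eq_bigr (fun i => (if i \in ~: S then phi else 1%R)%:E)); last first.
    move=> i _; rewrite inE /level_weight; have [_|_] := boolP (i \in S);
        rewrite /=.
      exact: integral_level_size.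
    exact: integral_layer.
  rewrite prod_EFin -big_mkcond prodr_const.
  by rewrite cardsCs finset.setCK card_ord cS addKn.
rewrite (eq_bigr _ LS) sumEFin lee_fin sumr_const.
have -> : #|[pred S : {set 'I_N} | #|S| == p]| = 'C(N, p).
  by rewrite -[N in RHS]card_ord -card_draws cardsE.
rewrite -[leLHS]mulr_natl.
have := bin_fact_le N p; rewrite -(ler_nat R) natrM natrX => CN.
have -> : ('C(N, p)%:R * (2 ^+ k * p`!%:R * eps ^+ k * phi ^+ k) =
   ('C(N, p)%:R * p`!%:R) * (2 ^+ k * phi ^+ k * eps ^+ k) :> R)%R by ring.
have -> : (2 ^+ k * N%:R ^+ p * phi ^+ k * eps ^+ k =
   N%:R ^+ p * (2 ^+ k * phi ^+ k * eps ^+ k) :> R)%R by ring.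
by apply: ler_wpM2r => //; rewrite !mulr_ge0 ?exprn_ge0.
Qed.

End density_bounds.

Lemma unit_completion (F : fieldType) (m k p : nat) (A : 'M[F]_(m, p + k))
    (km : (k <= m)%N) (mkp : (m - k <= p)%N) : row_free A ->
  exists B : 'M[F]_(p, p + k),
    [/\ forall j : 'I_(m - k), row (widen_ord mkp j) B =
        row (widen_ord (leq_subr k m) j) A,
        forall i, (exists j, row i B = row j A) \/
            (exists j, row i B = delta_mx ord0 j) &
        col_mx B (\matrix_(j < k) row (cast_ord (subnK km) (rshift (m - k) j))
            A) \in unitmx].
Proof.
move=> Af; set Z := \matrix_(j < k) _.
have pE : p = (m - k + (p - (m - k)))%N by rewrite subnKC.
have mq : (m + (p - (m - k)) = p + k)%N by rewrite -{1}(subnK km) addnAC -pE.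
have [w rw] := @row_free_complete F _ _ (p - (m - k))%N A Af (eq_leq mq).
set W := \matrix_(i < p - (m - k)) _ in rw.
pose B : 'M[F]_(p, p + k) := \matrix_(i < p)
  match fintype.split (cast_ord pE i) with
  | inl j => row (widen_ord (leq_subr k m) j) A
  | inr j => delta_mx ord0 (w j)
  end.
have BY (j : 'I_(m - k)) : row (widen_ord mkp j) B =
    row (widen_ord (leq_subr k m) j) A.
  rewrite rowK (_ : cast_ord _ _ = unsplit (inl j)) ?unsplitK//.
  exact/val_inj.
have BW (j : 'I_(p - (m - k))) : row (cast_ord (esym pE) (rshift (m - k) j)) B
    = row j W.
  by rewrite !rowK cast_ordKV (_ : rshift _ _ = unsplit (inr j)) ?unsplitK.
exists B; split => //.
  move=> i; rewrite rowK; case: (fintype.split _) => j; [left|right];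
      last by exists (w j).
  by exists (widen_ord (leq_subr k m) j).
rewrite -row_full_unit /row_full eqn_leq rank_leq_col -[X in (X <= _)%N]mq.
apply: leq_trans rw (mxrankS _); rewrite addsmx_sub; apply/andP; split.
  apply/row_subP => i.
  rewrite -(cast_ordKV (subnK km) i); case:
      (split_ordP (cast_ord (esym (subnK km)) i)) => j ->.
    have -> : cast_ord (subnK km) (lshift k j) =
        widen_ord (leq_subr k m) j by exact/val_inj.
    rewrite -BY; apply: submx_trans (row_sub _ _) _.
    by rewrite -(addsmxE B Z) addsmxSl.
  have -> : row (cast_ord (subnK km) (rshift (m - k) j)) A =
      row j Z by rewrite rowK.
  by apply: submx_trans (row_sub _ _) _; rewrite -(addsmxE B Z) addsmxSr.
apply/row_subP => j; rewrite -BW; apply: submx_trans (row_sub _ _) _.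
by rewrite -(addsmxE B Z) addsmxSl.
Qed.

Section density.
Context {R : realType}.
Local Notation leb := (@lebesgue_measure R).

Definition cutoff (f : R -> R) : R -> R := f \_ `[-1, 1]%classic.

Lemma cutoff_in f x : x \in `[-1, 1] -> cutoff f x = f x.
Proof. by move=> x1; rewrite /cutoff patchE mem_set. Qed.

Lemma cutoff_out f x : x \notin `[-1, 1] -> cutoff f x = 0.
Proof. by move=> x1; rewrite /cutoff patchE memNset//; exact/negP. Qed.

Lemma quasiconcave_level f t : quasiconcave f -> 0 < t ->
  is_interval [set x | t <= cutoff f x].
Proof.
move=> [x0 [x01 fl fr]] t0.
have lv x : t <= cutoff f x -> x \in `[-1, 1] /\ t <= f x.
  move=> tx; have [x1|x1] := boolP (x \in `[-1, 1]);
      first by rewrite -(cutoff_in f x1).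
  by move: tx; rewrite cutoff_out// leNgt t0.
move=> x y /= /lv[x1 tx] /lv[y1 ty] z /andP[xz zy].
move: x01 x1 y1; rewrite !in_itv/= => /andP[? ?] /andP[? ?] /andP[? ?].
rewrite cutoff_in ?in_itv/=; last by apply/andP; split; lra.
have [zx0|x0z] := leP z x0.
  by apply: le_trans tx _; apply: fl => //; rewrite in_itv/=; apply/andP;
      split; lra.
by apply: le_trans ty _; apply: fr => //; rewrite in_itv/=; apply/andP; split;
    lra.
Qed.

End density.

Theorem theorem4 (R : realType) (d : measure_display) (T : measurableType d)
    (P : probability T R) (n m k : nat)
    (X : 'I_n -> {RV P >-> R}) (phi : R) (f : 'I_n -> R -> R)
    (A : 'M[R]_(m, n)) (eps : R)
    (C : (m - k).-tuple R -> set (k.-tuple R))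
    (hX : independent_RVs X)
    (hf : forall i, has_density (X i) phi (f i))
    (hm : (1 <= m <= n)%N)
    (hA : forall i j, [\/ A i j = -1, A i j = 0 | A i j = 1])
    (hrank : \rank A = m)
    (hk : (1 <= k)%N) (hkm : (k < m)%N)
    (heps : 0 <= eps)
    (hC : forall y, hypercube eps (C y))
    (* measurability of the graph of C, implicit in speaking of the probability
       that (Z_1, ..., Z_k) lies in C(Y_1, ..., Y_{m-k}) *)
    (hCmeas : measurable [set yz : (m - k).-tuple R * k.-tuple R |
                            C yz.1 yz.2]) :
  let Y := fun w : T => first_coords k (linear_image A X w) in
  let Z := fun w : T => last_coords (ltnW hkm) (linear_image A X w) in
  (P [set w | C (Y w) (Z w)]
     <= ((2 * n%:R) ^+ (n - k) * phi ^+ n * eps ^+ k)%:E)%E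
  /\ ((forall i, quasiconcave (f i)) ->
      (P [set w | C (Y w) (Z w)]
         <= (2 ^+ k * n%:R ^+ (n - k) * phi ^+ k * eps ^+ k)%:E)%E).
Proof.
move=> Y Z; have /andP[_ mn] := hm.
have [p np] : exists p, n = (p + k)%N.
  by exists (n - k)%N; rewrite subnK// (leq_trans (ltnW hkm)).
subst n; rewrite addnK.
have mkp : (m - k <= p)%N by rewrite leq_subLR addnC.
have Af : row_free A by rewrite /row_free hrank.
have [B [BY BA BZu]] := unit_completion (ltnW hkm) mkp Af.
set Zm := \matrix_(j < k) _ in BZu.
pose i0 : 'I_(p + k) := Ordinal (leq_trans hk (leq_addl p k)).
have phi0 : 0 <= phi.
  have [_ /(_ 0) f01 _] := hf i0.
  have /andP[f0 f1] : 0 <= f i0 0 <= phi by apply: f01; rewrite in_itv/=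
      lerN10 ler01.
  exact: le_trans f1.
have A1 i j : `|A i j| <= 1.
  by case: (hA i j) => ->; rewrite ?normrN ?normr1 ?normr0.
have Aint i j : A i j \is a Num.int by case: (hA i j) => ->;
    rewrite ?rpredN ?rpred1 ?rpred0.
have B1 i j : `|B i j| <= 1.
  have -> : B i j = row i B 0 j by rewrite mxE.
  by have [[i' ->]|[j' ->]] := BA i; rewrite mxE// normr_nat lern1 leq_b1.
have Bint i j : B i j \is a Num.int.
  have -> : B i j = row i B 0 j by rewrite mxE.
  by have [[i' ->]|[j' ->]] := BA i; rewrite mxE ?rpred_nat.
have detBZ : 1 <= `|\det (col_mx B Zm)|.
  apply: det_ge1 => // i j; case: (split_ordP i) => l ->;
      first by rewrite col_mxEu.
  by rewrite col_mxEd !mxE.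
pose Ycoords (u : p.-tuple R) : (m - k).-tuple R :=
  [tuple tnth u (widen_ord mkp j) | j < m - k].
pose D u := C (Ycoords u).
have mYcoords : measurable_fun setT Ycoords.
  apply/measurable_fun_tnthP => i.
  rewrite (_ : _ \o _ = fun u => tnth u (widen_ord mkp i)); first exact:
      measurable_tnth.
  by apply/funext => u /=; rewrite tnth_mktuple.
have mD : measurable [set yz : p.-tuple R * k.-tuple R | D yz.1 yz.2].
  exact: measurable_graph_comp mYcoords hCmeas.
have mXt : measurable_fun setT (fun w => [tuple X i w | i < p + k]).
  apply/measurable_fun_tnthP => i.
  rewrite (_ : _ \o _ = X i); first exact: measurable_funPT.
  by apply/funext => w /=; rewrite tnth_mktuple.
pose Xt : {mfun T >-> (p + k).-tuple R} :=
  HB.pack (fun w => [tuple X i w | i < p + k])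
      (isMeasurableFun.Build _ _ _ _ _ mXt).
have tuple_colX w : tuple_col (Xt w) = \col_i X i w.
  by apply/colP => i; rewrite !mxE tnth_mktuple.
have -> : [set w | C (Y w) (Z w)] = Xt @^-1` graph_preimage D B Zm.
  apply/funext => w; rewrite /graph_preimage /= /D; congr (C _ _).
    apply: eq_from_tnth => j; rewrite !tnth_mktuple /linear_image tuple_colX.
    have /rowP BYj := BY j.
    by rewrite !mxE; apply: eq_bigr => l _; have := BYj l; rewrite !mxE => ->.
  apply: eq_from_tnth => j; rewrite !tnth_mktuple /linear_image tuple_colX !mxE.
  by apply: eq_bigr => l _; rewrite !mxE.
pose g i := cutoff (f i).
have m11 : measurable (`[-1, 1]%classic : set R) by exact: measurable_itv.
have mg i : measurable_fun setT (g i).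
  by apply/(measurable_restrictT _ _).1 => //; have [] := hf i.
have g_phi i x : 0 <= g i x <= phi.
  have [x1|x1] := boolP (x \in `[-1, 1]); last by rewrite /g cutoff_out// lexx.
  by rewrite /g cutoff_in//; have [_ + _] := hf i; apply.
have g_out i x : 1 < `|x| -> g i x = 0.
  by move=> x1; rewrite /g cutoff_out// in_itv/= -ler_norml -ltNge.
have gE i B' : measurable B' ->
    P (X i @^-1` B') = (\int[lebesgue_measure]_(x in B') (g i x)%:E)%E.
  move=> mB'; have [_ _ ->//] := hf i; rewrite integral_mkcondr.
  by apply: eq_integral => x _; rewrite /g /cutoff !patchE; case: ifP.
have g_int i : (\int[lebesgue_measure]_x (g i x)%:E = 1)%E.
  by rewrite -gE// preimage_setT probability_setT.
have mE : measurable (graph_preimage D B Zm) by exact: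
    measurable_graph_preimage.
rewrite (@law_tuple _ _ _ P _ Xt g)//; last 2 first.
- by move=> i x; have /andP[] := g_phi i x.
- move=> B' mB'; have := hX finset.setT B' (fun i _ => mB' i).
  rewrite (_ : \bigcap_(i in _) _ = Xt @^-1` box B'); last first.
    apply/seteqP; split => w /=.
      by move=> XB i; rewrite tnth_mktuple; apply: XB; rewrite /= inE.
    by move=> XB i _; have := XB i; rewrite tnth_mktuple.
  move=> ->; rewrite (eq_bigl predT); last by move=> i; rewrite inE.
  by apply: eq_bigr => i _; exact: gE.
have cubeD u : hypercube eps (D u) by exact: hC.
split.
  exact: iint_density_bounded.
move=> fq; apply: iint_density_quasiconcave => // i t; exact:
    quasiconcave_level.
Qed.
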